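(* Let $F$ be a finite field with $|F|=q$. Let $n_1,n_2,\dots$ be odd integers $>1$ coprime to $q$ such that $\lim_{i\to\infty}\frac{\log_q n_i}{\mu_q(n_i)}=0$. Let $G_i$ be any abelian group of order $n_i$ for $i=1,2,\dots$. If $q$ is even or $q\equiv 1\pmod 4$, then there exist self-dual $2$-quasi-$FG_i$ codes $C_i$ of type I, $i=1,2,\dots$, such that the code sequence $C_1,C_2,\dots$ is asymptotically good.
   Context: For an integer $n>1$ coprime to $q$, the $q$-cyclotomic cosets of $\mathbb{Z}_n=\mathbb{Z}/n\mathbb{Z}$ are the orbits of multiplication by $q$ on $\mathbb{Z}_n$; $\{0\}$ is the trivial one, and $\mu_q(n)$ is the minimal size of the non-trivial $q$-cyclotomic cosets. For an abelian group $G$ of order $n$, $FG$ is the group algebra; $a=\sum_{x\in G}a_xx\in FG$ is identified with the word $(a_x)_{x\in G}\in F^n$, and $(FG)^2=FG\times FG$ with $F^{2n}$. The Hamming weight $\mathrm{w}(a,b)$ of $(a,b)\in(FG)^2$ is the number of nonzero coordinates among the $2n$ coordinates. The inner product on $(FG)^2$ is the Euclidean one: $\langle(a,b),(a',b')\rangle=\sum_{x\in G}(a_xa'_x+b_xb'_x)$. A $2$-quasi-$FG$ code is an $FG$-submodule $C$ of $(FG)^2$; it is of type I if $C=C_{1,b}:=\{(u,ub)\mid u\in FG\}$ for some $b\in FG$. $C$ is self-dual if $C=C^\perp$. Its rate is $R(C)=\frac{\dim_F C}{2n}$ and its relative minimum distance is $\Delta(C)=\frac{\mathrm{w}(C)}{2n}$,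 where $\mathrm{w}(C)$ is the minimum Hamming weight of the nonzero elements of $C$. A code sequence $C_1,C_2,\dots$ is asymptotically good if the length of $C_i$ goes to infinity and both $R(C_i)$ and $\Delta(C_i)$, $i=1,2,\dots$, are bounded from below by a positive constant. *)

(* Defs.v *)
From HB Require Import structures.
From mathcomp Require Import all_boot all_order all_algebra all_fingroup.
From mathcomp Require Import all_classical all_reals all_analysis.

Set Implicit Arguments.
Unset Strict Implicit.
Unset Printing Implicit Defensive.

Import Order.TTheory GRing.Theory Num.Theory.
Import numFieldNormedType.Exports.

Local Open Scope ring_scope.

(* The ring instance of {ffun gT -> F^o} is the pointwise one, so the group
   algebra is a new type with the convolution product. The coefficients are
   taken in F^o (convertible to F) to inherit the F-vector space structure. *)
Definition group_algebra (F : finFieldType) (gT : finGroupType) : Type :=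
  {ffun gT -> F^o}.

Definition coef (F : finFieldType) (gT : finGroupType)
  (a : group_algebra F gT) (x : gT) : F := (a : {ffun gT -> F^o}) x.

Section GroupAlgebra.
Variables (F : finFieldType) (gT : finGroupType).
Local Notation FG := (group_algebra F gT).

HB.instance Definition _ := Finite.copy FG {ffun gT -> F^o}.
HB.instance Definition _ := Vector.copy FG {ffun gT -> F^o}.

Definition ga_one : FG := [ffun x : gT => ((x == 1%g)%:R : F^o)].

Definition ga_mul (a b : FG) : FG :=
  [ffun z : gT => (\sum_(x : gT) coef a x * coef b (x^-1 * z)%g : F^o)].

Lemma ga_eqP (a b : FG) : coef a =1 coef b -> a = b.
Proof. by move=> e; apply/ffunP. Qed.

Lemma coef_one x : coef ga_one x = (x == 1%g)%:R.
Proof. exact: ffunE. Qed.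

Lemma coef_mul a b z :
  coef (ga_mul a b) z = \sum_(x : gT) coef a x * coef b (x^-1 * z)%g.
Proof. exact: ffunE. Qed.

Lemma coefD a b x : coef (a + b) x = coef a x + coef b x.
Proof. exact: ffunE. Qed.

Lemma coefZ k a x : coef (k *: a) x = k * coef a x.
Proof. exact: ffunE. Qed.

Lemma coef0 x : coef (0 : FG) x = 0.
Proof. exact: ffunE. Qed.

Fact ga_mulA : associative ga_mul.
Proof.
move=> a b c; apply: ga_eqP => z; rewrite !coef_mul.
under [RHS]eq_bigr => x _ do rewrite coef_mul mulr_suml.
rewrite exchange_big /=; apply: eq_bigr => x _.
rewrite coef_mul mulr_sumr (reindex_inj (mulgI x^-1%g)) /=.
by apply: eq_bigr => y _; rewrite mulrA invMg invgK -!mulgA mulKVg.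
Qed.

Fact ga_mul1l : left_id ga_one ga_mul.
Proof.
move=> a; apply: ga_eqP => z; rewrite coef_mul (bigD1 1%g) //= big1.
  by rewrite coef_one eqxx mul1r invg1 mul1g addr0.
by move=> x /negPf x1; rewrite coef_one x1 mul0r.
Qed.

Fact ga_mul1r : right_id ga_one ga_mul.
Proof.
move=> a; apply: ga_eqP => z; rewrite coef_mul (bigD1 z) //= big1.
  by rewrite coef_one mulVg eqxx mulr1 addr0.
move=> x xz; rewrite coef_one -eq_mulVg1.
by rewrite (negPf xz) mulr0.
Qed.

Fact ga_mulDl : left_distributive ga_mul +%R.
Proof.
move=> a b c; apply: ga_eqP => z; rewrite coefD !coef_mul -big_split /=.
by apply: eq_bigr => x _; rewrite coefD mulrDl.
Qed.

Fact ga_mulDr : right_distributive ga_mul +%R.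
Proof.
move=> a b c; apply: ga_eqP => z; rewrite coefD !coef_mul -big_split /=.
by apply: eq_bigr => x _; rewrite coefD mulrDr.
Qed.

Fact ga_one_neq0 : ga_one != 0.
Proof.
apply/eqP => /(congr1 (fun a => coef a 1%g)).
by rewrite coef_one coef0 eqxx; apply/eqP; rewrite oner_eq0.
Qed.

HB.instance Definition _ := GRing.Zmodule_isNzRing.Build FG
  ga_mulA ga_mul1l ga_mul1r ga_mulDl ga_mulDr ga_one_neq0.

Fact ga_scaleAl (k : F) (a b : FG) : k *: (a * b) = (k *: a) * b.
Proof.
apply: ga_eqP => z; rewrite coefZ !coef_mul mulr_sumr.
by apply: eq_bigr => x _; rewrite coefZ mulrA.
Qed.

HB.instance Definition _ := GRing.Lmodule_isLalgebra.Build F FG ga_scaleAl.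

Fact ga_scaleAr (k : F) (a b : FG) : k *: (a * b) = a * (k *: b).
Proof.
apply: ga_eqP => z; rewrite coefZ !coef_mul mulr_sumr.
by apply: eq_bigr => x _; rewrite coefZ mulrCA.
Qed.

HB.instance Definition _ := GRing.Lalgebra_isAlgebra.Build F FG ga_scaleAr.

End GroupAlgebra.

Section Codes.
Variables (F : finFieldType) (gT : finGroupType).
Local Notation FG := (group_algebra F gT).

Definition code_length : nat := (2 * #|gT|)%N.

Definition hamming_weight (v : FG * FG) : nat :=
  (#|[set x : gT | coef v.1 x != 0%R]|
     + #|[set x : gT | coef v.2 x != 0%R]|)%N.

Definition inner_product (v w : FG * FG) : F :=
  \sum_(x : gT) (coef v.1 x * coef w.1 x + coef v.2 x * coef w.2 x).

Definition dual_code (C : {vspace FG * FG}) : {set FG * FG} :=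
  [set v | [forall c in C, inner_product v c == 0]].

Definition self_dual (C : {vspace FG * FG}) : Prop := C =i dual_code C.

Definition quasi_FG_code (C : {vspace FG * FG}) : Prop :=
  forall (a : FG) (c : FG * FG), c \in C -> (a * c.1, a * c.2) \in C.

Definition code1 (b : FG) : {set FG * FG} := [set (u, u * b) | u : FG].

Definition type_I (C : {vspace FG * FG}) : Prop :=
  exists b : FG, C =i code1 b.

(* The default value of the minimum only matters for the zero code: the weight
   of any word is at most code_length. *)
Definition min_weight (C : {vspace FG * FG}) : nat :=
  \big[minn/code_length]_(c : FG * FG | (c \in C) && (c != 0))
     hamming_weight c.

Definition rate (R : realType) (C : {vspace FG * FG}) : R :=
  (\dim C)%:R / code_length%:R.

Definition relative_distance (R : realType) (C : {vspace FG * FG}) : R :=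
  (min_weight C)%:R / code_length%:R.

End Codes.

Definition asymptotically_good (R : realType) (F : finFieldType)
    (gT : nat -> finGroupType)
    (C : forall i, {vspace group_algebra F (gT i) * group_algebra F (gT i)}) :
    Prop :=
  (code_length (gT i) @[i --> \oo] --> \oo)%classic /\
  exists2 delta : R, 0 < delta &
    forall i, delta <= rate R (C i) /\ delta <= relative_distance R (C i).

(* 'Z_n is the ring of integers mod n only for n > 1. For q coprime to n,
   multiplication by q permutes 'Z_n, so that the forward orbit below is the
   whole orbit. *)
Definition cyclotomic_coset (q n : nat) (x : 'Z_n) : {set 'Z_n} :=
  [set y in fingraph.orbit (fun z : 'Z_n => q%:R * z) x].

Definition cyclotomic_cosets (q n : nat) : {set {set 'Z_n}} :=
  [set cyclotomic_coset q x | x : 'Z_n].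

(* For n > 1 there is a non-trivial coset and all cosets have size at most n,
   so the default value n is harmless. *)
Definition mu (q n : nat) : nat :=
  \big[minn/n]_(Q in cyclotomic_cosets q n | Q != [set 0]) #|Q|.

Definition log_base (R : realType) (b x : R) : R := ln x / ln b.

(* Main.v *)
(* Write b = s c with s ^ 2 = -1 in F. Then C_{1,b} is self-dual iff c is
   unitary, i.e. c * bar c = 1 for the involution bar induced by x |-> x^-1, so
   it suffices to find a unitary c such that u and u c never both have low
   weight for u <> 0. A random unitary c works, by a union bound over the
   ideals e FG, e idempotent: if dim (e FG) = d then a low-weight u generating
   that ideal is one of few words (an ideal has an information set, and its
   translates cover the group evenly), so is u c, and for given u and u c the
   element c varies in a coset of the stabilizer of e. The index of that
   stabilizer is at least q ^ (d / 4): it is the size of a unitary group, which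
   is bounded below one field component at a time, with Hilbert 90 when bar
   preserves the component. Non-trivial components have dimension at least
   mu_q(n), and the hypothesis makes the sum over all idempotents of a
   multiplicative weight (1 + n ^ -2) ^ n < 2. *)
Require Import Defs.
From HB Require Import structures.
From mathcomp Require Import all_boot all_order all_algebra all_fingroup.
From mathcomp Require Import all_solvable all_field.
From mathcomp Require Import ring lra zify.
Import Order.TTheory GRing.Theory Num.Theory.
Local Open Scope ring_scope.

Set Implicit Arguments.
Unset Strict Implicit.
Unset Printing Implicit Defensive.

Lemma card_fiber_le (S T : finType) (A : {set S}) (B : {set T}) (g : S -> T)
    (k : nat) :
  {in A, forall x, g x \in B} ->
  {in A, forall x, #|[set y in A | g y == g x]| <= k}%N -> (#|A| <= #|B| * k)%N.
Proof.
move=> gB fib; rewrite -sum1_card (partition_big g (mem B)) //=.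
rewrite -sum_nat_const; apply: leq_sum => y _.
rewrite sum1_card; case: (pickP [pred x in A | g x == y]) =>
  [x /andP[xA /eqP <-]|e].
  by apply: leq_trans (fib x xA); rewrite subset_leq_card //;
    apply/subsetP => z; rewrite inE.
by rewrite eq_card0.
Qed.

(** * Idempotents of a finite commutative ring and the ideals they generate *)

Section CornerRings.
Variables (A : finComNzRingType).
Implicit Types e f p x : A.

Definition idem e := e * e == e.
Definition corner e : {set A} := [set x | e * x == x].
Arguments corner e%_ring_scope.
(** The primitive idempotents; in the periodic rings considered below, their corners are the field
    components. *)
Definition atom p :=
  [&& p != 0, idem p & [forall e, idem e ==> (p * e == 0) || (p * e == p)]].

Lemma cornerP e x : reflect (e * x = x) (x \in corner e).
Proof. by rewrite inE; apply: eqP. Qed.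

Lemma corner_mul e x : idem e -> e * x \in corner e.
Proof. by move=> /eqP ee; rewrite inE mulrA ee. Qed.

Lemma idem0 : idem 0. Proof. by rewrite /idem mulr0. Qed.

Lemma idem1 : idem 1. Proof. by rewrite /idem mulr1. Qed.

Lemma idemM e f : idem e -> idem f -> idem (e * f).
Proof. by move=> /eqP ee /eqP ff; rewrite /idem mulrACA ee ff. Qed.

Lemma idemD e f : idem e -> idem f -> e * f = 0 -> idem (e + f).
Proof.
move=> /eqP ee /eqP ff ef.
by rewrite /idem mulrDl !mulrDr ee ff (mulrC f) ef addr0 add0r.
Qed.

Lemma idemB e f : idem e -> idem f -> f * e = e -> idem (f - e).
Proof.
move=> /eqP ee /eqP ff fe.
by rewrite /idem mulrBl !mulrBr ee ff (mulrC e) fe subrr subr0.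
Qed.

Lemma corner_sub e f : f * e = e -> corner e \subset corner f.
Proof.
by move=> fe; apply/subsetP => x /cornerP ex; apply/cornerP; rewrite -ex mulrA fe.
Qed.

Lemma corner_gt0 e : (0 < #|corner e|)%N.
Proof. by rewrite (cardD1 0) inE mulr0 eqxx. Qed.

(** Peirce decomposition: [x] corresponds to the pair [(e * x, f * x)], and addition is the inverse
    map. *)
Lemma card_cornerD e f : idem e -> idem f -> e * f = 0 ->
  #|corner (e + f)| = (#|corner e| * #|corner f|)%N.
Proof.
move=> ie jf ef; have [/eqP ee /eqP ff] := (ie, jf).
have fe : f * e = 0 by rewrite mulrC.
rewrite -cardsX.
have inj : {in corner (e + f) &, injective (fun x => (e * x, f * x))}.
  by move=> x y /cornerP <- /cornerP <-; rewrite !mulrDl => -[];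
    rewrite !mulrDr !mulrA ee ff ef fe !mul0r !(addr0, add0r) => -> ->.
rewrite -(card_in_imset inj); apply: eq_card => -[y z].
apply/imsetP/setXP => [[x xef [-> ->]]|[/cornerP ey /cornerP fz]].
  by rewrite !corner_mul.
have ez : e * z = 0 by rewrite -fz mulrA ef mul0r.
have fy : f * y = 0 by rewrite -ey mulrA fe mul0r.
exists (y + z); last by rewrite !mulrDr ey fz ez fy addr0 add0r.
by apply/cornerP; rewrite mulrDl !mulrDr ey fz ez fy addr0 add0r.
Qed.

Lemma atomP p : reflect
  [/\ p != 0, p * p = p & forall e, idem e -> p * e = 0 \/ p * e = p] (atom p).
Proof.
apply: (iffP and3P) => [[p0 /eqP pp /forallP h]|[p0 pp h]]; split => //.
- by move=> e ie; move/implyP: (h e) => /(_ ie)/orP[]/eqP; [left|right].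
- exact/eqP.
- by apply/forallP => e; apply/implyP => /h[]->; rewrite eqxx ?orbT.
Qed.

Lemma atom_idem p : atom p -> idem p.
Proof. by case/atomP=> _ /eqP. Qed.

(** A nonzero idempotent [p] below [f] with smallest corner is primitive: if [p * e] is nonzero, its
    corner lies in that of [p], so the two agree and [p] itself is fixed by [e]. *)
Lemma exists_atom f : idem f -> f != 0 -> exists2 p, atom p & f * p = p.
Proof.
move=> jf f0.
pose P e := [&& idem e, e != 0 & f * e == e].
have Pf : P f by rewrite /P jf f0.
case: (arg_minnP (fun e => #|corner e|) Pf) => p /and3P[ip p0 /eqP fp] minp.
exists p => //; apply/atomP; split=> //; first exact/eqP.
move=> e ie; have [->|pe0] := eqVneq (p * e) 0; [by left|right].
have ppe : p * (p * e) = p * e by rewrite mulrA (eqP ip).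
have /minp le : P (p * e) by rewrite /P idemM // pe0 mulrA fp /=.
have /eqP E : corner (p * e) == corner p.
  by rewrite eqEcard corner_sub // le.
have : p \in corner (p * e) by rewrite E inE.
by move/cornerP; rewrite mulrAC (eqP ip).
Qed.

(** Idempotents below [f] are sums of sets of atoms, so the sum factors as the product of [1 + w p]
    over the atoms. Each atom uses up a factor at least [q] of [#|corner f|], so there are at most
    [m] of them. *)
Lemma sum_idem_le (R : realDomainType) (w : A -> R) (eps : R) (q m : nat) f :
    (1 < q)%N -> 0 <= eps -> (forall e, 0 <= w e) -> w 0 = 1 ->
    (forall e e', idem e -> idem e' -> e * e' = 0 -> w (e + e') = w e * w e') ->
    idem f -> (#|corner f| <= q ^ m)%N ->
    (forall p, atom p -> f * p = p -> (q <= #|corner p|)%N /\ w p <= eps) ->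
  \sum_(e | idem e && (f * e == e)) w e <= (1 + eps) ^+ m.
Proof.
move=> q1 eps0 w0 w00 wD; elim: m f => [|m IH] f jf cf hat.
all: have [f0|f0] := eqVneq f 0.
1,3: rewrite (big_pred1 0) ?w00 ?exprn_ege1 ?lerDl // => e /=;
  rewrite f0 mul0r [0 == e]eq_sym;
     by case: (eqVneq e 0) => [->|]; rewrite ?idem0 ?andbF.
  case/negP: f0; move: cf; rewrite expn0 => /card_le1_eqP h.
  by apply/eqP/esym/h; rewrite inE ?mulr0 ?(eqP jf).
have [p ap fp] := exists_atom jf f0; have ip := atom_idem ap.
have [qp wp] := hat p ap fp.
have [_ pp pdich] := atomP _ ap.
have pf : p * f = p by rewrite mulrC.
have jfp : idem (f - p) by apply: idemB.
have pfp : p * (f - p) = 0 by rewrite mulrBr pp pf subrr.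
have Ef : p + (f - p) = f by rewrite addrC subrK.
have cfE := card_cornerD ip jfp pfp; rewrite Ef in cfE.
have cfp : (#|corner (f - p)| <= q ^ m)%N.
  rewrite -(leq_pmul2l (ltnW q1)) -expnS; apply: leq_trans cf; rewrite cfE.
  by rewrite leq_mul2r qp orbT.
have {}IH : \sum_(e | idem e && ((f - p) * e == e)) w e <= (1 + eps) ^+ m.
  apply: IH => // p' ap' e; apply: hat => //.
  by rewrite -e mulrA mulrBr (eqP jf) fp.
have below e : (f - p) * e = e -> p * e = 0 /\ f * e = e.
  move=> h; have pe : p * e = 0 by rewrite -h mulrA pfp mul0r.
  by split=> //; move: h; rewrite mulrBl pe subr0.
(* An idempotent below [f] is either orthogonal to [p], hence below [f - p], or the sum of [p] and
   one of that kind. *)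
rewrite (bigID (fun e => p * e == 0)) /= exprS mulrDl mul1r lerD //.
  apply: le_trans IH; rewrite le_eqVlt; apply/orP; left; apply/eqP.
  apply: eq_bigl => e; rewrite -andbA; congr (_ && _).
  apply/andP/eqP => [[/eqP fe /eqP pe]|/below[pe fe]]; last by rewrite fe pe !eqxx.
  by rewrite mulrBl fe pe subr0.
rewrite (reindex_onto (fun e => p + e) (fun e => e - p)) /=; last first.
  by move=> e _; rewrite addrC subrK.
rewrite (eq_bigl (fun e => idem e && ((f - p) * e == e))); last first.
  move=> e; rewrite [p + e]addrC addrK eqxx andbT.
  apply/andP/andP => [[/andP[ie /eqP fe] pe]|[ie /eqP /below[pe fe]]].
    have {}pe : p * (e + p) = p.
      by case: (pdich _ ie) pe => -> //; rewrite eqxx.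
    have pe0 : p * e = 0.
      by apply: (addIr p); rewrite add0r -{2}pp -mulrDr.
    have fe' : f * e = e by apply: (addIr p); rewrite -{1}fp -mulrDr.
    split; last by rewrite mulrBl fe' pe0 subr0.
    by rewrite -(addrK p e) idemB // mulrC.
  by rewrite [e + p]addrC idemD // !mulrDr pe fe fp pp addr0 eqxx; case/atomP: ap.
rewrite (eq_bigr (fun e => w p * w e)) => [|e /andP[ie /eqP/below[pe _]]];
  last exact: wD.
by rewrite -mulr_sumr ler_pM // sumr_ge0.
Qed.

End CornerRings.

(** * Unitary elements for an involution, and lower bounds for their number *)

Section UnitaryGroup.
Variables (A : finComNzRingType) (bar : {rmorphism A -> A}).
Hypothesis barK : involutive bar.
Implicit Types e f p x : A.

Definition unitary f : {set A} := [set x in corner f | x * bar x == f].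
Arguments unitary f%_ring_scope.

Lemma unitaryP f x : reflect (f * x = x /\ x * bar x = f) (x \in unitary f).
Proof. by rewrite !inE; apply: (iffP andP) => -[/eqP ? /eqP ?]. Qed.

Lemma unitary1P x : reflect (x * bar x = 1) (x \in unitary 1).
Proof. by apply: (iffP (unitaryP _ _)) => [[]|]; rewrite ?mul1r. Qed.

Lemma bar_eq0 x : (bar x == 0) = (x == 0).
Proof. by rewrite -(rmorph0 bar) (inj_eq (inv_inj barK)) rmorph0. Qed.

Lemma idem_bar e : idem e -> idem (bar e).
Proof. by move=> /eqP ee; rewrite /idem -rmorphM ee. Qed.

Lemma corner_bar e : #|corner (bar e)| = #|corner e|.
Proof.
rewrite -(card_imset (corner e) (inv_inj barK)); apply: eq_card => x.
apply/cornerP/imsetP => [h|[y /cornerP h ->]]; last by rewrite -rmorphM h.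
by exists (bar x); rewrite ?barK // inE -{2}h rmorphM barK.
Qed.

Lemma atom_bar p : atom p -> atom (bar p).
Proof.
case/atomP=> p0 pp h; apply/atomP; split; first by rewrite bar_eq0.
  by rewrite -rmorphM pp.
move=> e /idem_bar/h[] /(congr1 bar); rewrite rmorphM barK ?rmorph0;
  by [left|right].
Qed.

Lemma card_unitaryD f g : f * g = 0 -> bar f = f -> bar g = g ->
  (#|unitary f| * #|unitary g| <= #|unitary (f + g)|)%N.
Proof.
move=> fg bf bg; rewrite -cardsX.
have orth x y : x \in unitary f -> y \in unitary g -> 
    [/\ f * y = 0, g * x = 0, x * bar y = 0 & y * bar x = 0].
  move=> /unitaryP[fx _] /unitaryP[gy _]; rewrite -fx -gy.
  split; rewrite ?rmorphM ?bf ?bg.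
  - by rewrite mulrA fg mul0r.
  - by rewrite mulrA (mulrC g) fg mul0r.
  - by rewrite mulrACA fg mul0r.
  - by rewrite mulrACA (mulrC g) fg mul0r.
rewrite -(@card_in_imset _ _ (fun xy => xy.1 + xy.2)) => [|[x y] [x' y']] /=.
  apply/subset_leq_card/subsetP => _ /imsetP[[x y] /setXP[xU yU] ->] /=.
  have [fy gx xy yx] := orth _ _ xU yU.
  move: xU yU => /unitaryP[fx xx] /unitaryP[gy yy].
  apply/unitaryP; rewrite rmorphD; split.
    by rewrite mulrDl !mulrDr fx fy gx gy addr0 add0r.
  by rewrite mulrDl !mulrDr xx xy yx yy addr0 add0r.
move=> /setXP[xU yU] /setXP[xU' yU'] E.
have [fy gx _ _] := orth _ _ xU yU; have [fy' gx' _ _] := orth _ _ xU' yU'.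
move: xU yU xU' yU' => /unitaryP[fx xx] /unitaryP[gy yy] /unitaryP[fx' _]
  /unitaryP[gy' _].
have := congr1 ( *%R f) E; rewrite !mulrDr fx fx' fy fy' !addr0 => ->.
by have := congr1 ( *%R g) E; rewrite !mulrDr gx gx' gy gy' !add0r => ->.
Qed.

(** [f] is the join of [e] and [bar e]. A unitary [c] fixing [e] fixes [bar e] too, hence [f], while
    [w + (1 - f)] extends a unitary [w] of [corner f] to the whole ring. The products of the two
    kinds are distinct, because multiplication by [f] recovers [w]. *)
Lemma unitary_stab_le e f : idem e -> f = e + bar e - e * bar e ->
  (#|[set c in unitary 1 | (e * c == e)%R]| * #|unitary f| <= #|unitary 1|)%N.
Proof.
move=> /eqP ee fE.
have bb : bar e * bar e = bar e by rewrite -rmorphM ee.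
have bf : bar f = f.
  by rewrite fE rmorphB rmorphD rmorphM barK (addrC e) (mulrC e).
have ff : f * f = f.
  rewrite fE; transitivity (e * e + bar e * bar e + (e * e) * (bar e * bar e)
    + (1 + 1) * (e * bar e) - (1 + 1) * ((e * e) * bar e) - (1 + 1) * (e * (bar
      e * bar e))).
    by ring.
  by rewrite ee bb; ring.
rewrite -cardsX.
have fc c : c \in [set c in unitary 1 | (e * c == e)%R] -> f * c = f.
  rewrite inE => /andP[/unitary1P cc /eqP ec].
  have bec : bar e * c = bar e.
    have : e * bar c = e by rewrite -{1}ec -mulrA cc mulr1.
    by move/(congr1 bar); rewrite rmorphM barK.
  by rewrite fE mulrBl mulrDl ec bec -mulrA bec.
have unit_w w : w \in unitary f -> (w + (1 - f)) * (bar w + (1 - f)) = 1.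
  move=> /unitaryP[fw ww].
  have fbw : f * bar w = bar w by rewrite -{1}bf -rmorphM fw.
  transitivity (w * bar w + (1 - f) * (w + bar w) + (1 - f) * (1 - f));
    first by ring.
  rewrite ww; transitivity (f + (w + bar w) - (f * w) - f * bar w + 1 - (1 + 1)
    * f + f * f); first by ring.
  by rewrite fw fbw ff; ring.
rewrite -(@card_in_imset _ _ (fun cw => cw.1 * (cw.2 + (1 - f)))) =>
  [|[c w] [c' w']] /=.
  apply/subset_leq_card/subsetP => _ /imsetP[[c w] /setXP[cU wU] ->] /=.
  move: cU; rewrite inE => /andP[/unitary1P cc _].
  by apply/unitary1P; rewrite rmorphM rmorphD rmorphB rmorph1 bf mulrACA cc
    mul1r unit_w.
move=> /setXP[/= cU wU] /setXP[/= cU' wU'] E.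
have ww' : w = w'.
  have := congr1 ( *%R f) E;
    rewrite !mulrA (fc c cU) (fc c' cU') !mulrDr mulr1 mulrN ff subrr !addr0.
  by move: wU wU' => /unitaryP[-> _] /unitaryP[-> _].
rewrite -ww' in E *; congr (_, _).
have := congr1 ( *%R^~ (bar w + (1 - f))) E.
by rewrite /= -!mulrA unit_w // !mulr1.
Qed.

Variable N : nat.
Hypothesis expr_periodic : forall x, x ^+ N.+3 = x.

(** [x ^+ N.+2] is the idempotent generating the ideal of [x], and [x ^+ N.+1], still a positive
    power, is the inverse of [x] in its corner. *)
Lemma support_idem x : idem (x ^+ N.+2).
Proof. by rewrite /idem -exprD addSnnS exprD expr_periodic -exprSr. Qed.

Lemma support_mul x : x ^+ N.+2 * x = x.
Proof. by rewrite -exprSr. Qed.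

(** This makes the corner of an atom a field: the support of [x] is a nonzero idempotent below [p],
    so it is [p]. *)
Lemma atom_expr p x : atom p -> x \in corner p -> x != 0 -> x ^+ N.+2 = p.
Proof.
case/atomP=> p0 pp h /cornerP px x0.
have E : p * x ^+ N.+2 = x ^+ N.+2 by rewrite exprS mulrA px.
case: (h _ (support_idem x)) => [|<-]; last by rewrite E.
by rewrite E => e0; case/eqP: x0; rewrite -[x]support_mul e0 mul0r.
Qed.

Lemma atom_mulI p x y z : atom p -> x \in corner p -> x != 0 ->
  y \in corner p -> z \in corner p -> y * x = z * x -> y = z.
Proof.
move=> ap xp x0 /cornerP py /cornerP pz E.
have xx : x * x ^+ N.+1 = p by rewrite -exprS (atom_expr ap xp x0).
by rewrite -py -pz -xx mulrC [RHS]mulrC !mulrA E.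
Qed.

(* Hilbert 90: [t / bar t] is unitary, with fibres the cosets of the units of
   the subfield fixed by [bar], which has at most [sqrt #|corner p|] elements. *)
Lemma card_corner_self p : atom p -> bar p = p ->
    (exists2 x, x \in corner p & bar x != x) ->
  (#|corner p| <= #|unitary p| ^ 2)%N.
Proof.
move=> ap bp [th thp bth]; have [p0 pp _] := atomP _ ap.
have cM x y : x \in corner p -> y \in corner p -> x * y \in corner p.
  by move=> /cornerP px _; apply/cornerP; rewrite mulrA px.
have cB x y : x \in corner p -> y \in corner p -> x - y \in corner p.
  by move=> /cornerP px /cornerP py; apply/cornerP; rewrite mulrBr px py.
have cX x k : x \in corner p -> x ^+ k.+1 \in corner p.
  by move=> xp; rewrite exprS; apply/cornerP; rewrite mulrA (cornerP _ _ xp).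
have cbar x : x \in corner p -> bar x \in corner p.
  by move=> /cornerP px; apply/cornerP; rewrite -{1}bp -rmorphM px.
pose K := corner p :\ 0; pose K0 := [set x in corner p | bar x == x].
pose K1 := K0 :\ 0.
have cK : #|corner p| = #|K|.+1 by rewrite (cardsD1 0 (corner p)) inE mulr0 eqxx.
have cK0 : #|K0| = #|K1|.+1.
  by rewrite (cardsD1 0 K0) !inE mulr0 rmorph0 !eqxx.
have xV x : x \in corner p -> x != 0 -> x * x ^+ N.+1 = p.
  by move=> xp x0; rewrite -exprS (atom_expr ap xp).
have K0P x : x \in K0 -> x \in corner p /\ bar x = x.
  by rewrite inE => /andP[? /eqP].
(* [x + y * th] determines [x] and [y] in the fixed field [K0]: otherwise [th] would be a quotient
   of fixed elements, against [bth]. *)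
have sq : (#|K0| * #|K0| <= #|corner p|)%N.
  rewrite -cardsX -(@card_in_imset _ _ (fun xy => xy.1 + xy.2 * th)).
    apply/subset_leq_card/subsetP =>
      _ /imsetP[[x y] /setXP[/K0P[xp _] /K0P[yp _]] ->].
    by apply/cornerP; rewrite mulrDr mulrA (cornerP _ _ xp) (cornerP _ _ yp).
  move=> [a b] [a' b'] /setXP[/K0P[ap' ba] /K0P[bp' bb]].
  move=> /setXP[/K0P[ap'' ba'] /K0P[bp'' bb']] /= E.
  have [bb0|bb0] := eqVneq (b - b') 0.
    by move/eqP: bb0; rewrite subr_eq0 => /eqP bE; rewrite bE in E *;
      rewrite (addIr _ E).
  have E1 : (b - b') * th = a' - a.
    have bE : b * th = a' + b' * th - a by rewrite -E [a + _]addrC addrK.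
    by rewrite mulrBl bE addrAC addrK.
  have E2 : (b - b') * bar th = a' - a.
    by have := congr1 bar E1; rewrite rmorphM !rmorphB bb bb' ba ba'.
  case/eqP: bth; apply: (@atom_mulI p (b - b')) => //; rewrite ?cB ?cbar //.
  by rewrite mulrC E2 -E1 mulrC.
have fib : (#|K| <= #|unitary p| * #|K1|)%N.
  apply: (@card_fiber_le _ _ _ _ (fun t => t * bar t ^+ N.+1)).
    move=> t; rewrite !inE => /andP[t0 /eqP pt];
      have tp : t \in corner p by rewrite inE pt.
    rewrite mulrA pt eqxx /= rmorphM rmorphXn barK.
    have bt0 : bar t != 0 by rewrite bar_eq0.
    by rewrite [bar t * _]mulrC mulrACA xV // [_ * bar t]mulrC xV ?cbar // pp.
  move=> t; rewrite 2!inE => /andP[t0 tp].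
  have bt0 : bar t != 0 by rewrite bar_eq0.
  have t'p := cX _ N tp.
  have t'0 : t ^+ N.+1 != 0.
    by apply: contra_neq p0 => h; rewrite -(xV t tp t0) h mulr0.
  (* Division by [t] embeds the fibre of [t] into the nonzero fixed elements. *)
  rewrite -(@card_in_imset _ _ ( *%R^~ (t ^+ N.+1))); last first.
    move=> x y; rewrite !inE => /andP[/andP[_ px] _] /andP[/andP[_ py] _].
    by apply: (@atom_mulI p) => //; rewrite inE.
  apply/subset_leq_card/subsetP => z /imsetP[y yS ->{z}].
  move: yS; rewrite !inE => /andP[/andP[y0 /eqP py] /eqP E];
    have yp : y \in corner p by rewrite inE py.
  have by0 : bar y != 0 by rewrite bar_eq0.
  apply/and3P; split.
  - apply: contra_neq y0 => h; apply: (@atom_mulI p (t ^+ N.+1)) => //.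
      by rewrite inE mulr0.
    by rewrite h mul0r.
  - by rewrite mulrA py.
  have {}E : y * bar t = t * bar y.
    transitivity (y * bar y ^+ N.+1 * (bar y * bar t)).
      transitivity (y * bar t * (bar y * bar y ^+ N.+1)); last by ring.
      by rewrite xV ?cbar // [RHS]mulrC mulrA py.
    rewrite E; transitivity (t * bar y * (bar t * bar t ^+ N.+1)); first by ring.
    by rewrite xV ?cbar // mulrC mulrA (cornerP _ _ tp).
  have ttp : t * bar t \in corner p by apply: cM => //; apply: cbar.
  have tt0 : t * bar t != 0.
    apply: contra_neq t0 => h; apply: (@atom_mulI p (bar t)); rewrite ?cbar //.
      by rewrite inE mulr0.
    by rewrite h mul0r.
  have btp := cX _ N (cbar _ tp).
  rewrite rmorphM rmorphXn; apply/eqP.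
  apply: (atom_mulI ap ttp tt0); [by apply: cM => //; apply: cbar|exact: cM|].
  transitivity (bar y * t * (bar t * bar t ^+ N.+1)); first by ring.
  transitivity (y * bar t * (t * t ^+ N.+1)); last by ring.
  by rewrite !xV ?cbar // E (mulrC t).
have : (0 < #|K1|)%N.
  by apply/card_gt0P; exists p; rewrite !inE p0 pp bp !eqxx.
(* By [sq], [#|K|] is at least [#|K1| * (#|K1| + 2)], so [fib] gives [#|unitary p| >= #|K1| + 2],
   and then the square exceeds [#|K|]. *)
move: sq fib; rewrite cK cK0; nia.
Qed.

(** [bar] exchanges two field components, and [t] plus the inverse of [bar t] is unitary for every
    nonzero [t] in the first. This gives [k = #|corner p| - 1] unitary elements, and
    [(k + 1) ^ 2 <= k ^ 4] for [k >= 2]. *)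
Lemma card_corner_split p : atom p -> p * bar p = 0 -> (2 < #|corner p|)%N ->
  (#|corner (p + bar p)%R| <= #|unitary (p + bar p)%R| ^ 4)%N.
Proof.
move=> ap pbp c2; have [p0 pp _] := atomP _ ap.
rewrite card_cornerD ?idem_bar ?atom_idem // corner_bar.
have bpp : bar p * p = 0 by rewrite mulrC.
suff : (#|corner p :\ 0%R| <= #|unitary (p + bar p)%R|)%N.
  have : #|corner p| = #|corner p :\ 0%R|.+1.
    by rewrite (cardsD1 0 (corner p)) inE mulr0 eqxx.
  move=> cE le; move: c2; rewrite cE => k2.
  apply: (@leq_trans (#|corner p :\ 0%R| ^ 4)); last by rewrite leq_exp2r.
  by move: k2; clear; move: #|_| => k k2; rewrite !expnS expn0; nia.
rewrite -(@card_in_imset _ _ (fun t => t + bar t ^+ N.+1)) => [|x y].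
  apply/subset_leq_card/subsetP => _ /imsetP[t /setD1P[t0 tp] ->].
  have pt := cornerP _ _ tp;
    have bpt : bar p * bar t = bar t by rewrite -rmorphM pt.
  have tt : t * bar t = 0 by rewrite -pt rmorphM mulrACA pbp mul0r.
  have tV : t * t ^+ N.+1 = p by rewrite -exprS (atom_expr ap tp).
  have bt'p : bar p * bar t ^+ N.+1 = bar t ^+ N.+1 by rewrite exprS mulrA bpt.
  have t'p : p * t ^+ N.+1 = t ^+ N.+1 by rewrite exprS mulrA pt.
  have bV : bar t ^+ N.+1 * bar t = bar p
    by rewrite -exprSr -rmorphXn (atom_expr ap tp).
  have o1 : bar p * t = 0 by rewrite -pt mulrA bpp mul0r.
  have o2 : p * bar t ^+ N.+1 = 0 by rewrite -bt'p mulrA pbp mul0r.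
  have o3 : bar t ^+ N.+1 * t ^+ N.+1 = 0 by rewrite -t'p -bt'p mulrACA bpp mul0r.
  apply/unitaryP; split; first by rewrite mulrDl !mulrDr pt bt'p o1 o2 addr0 add0r.
  by rewrite rmorphD rmorphXn barK mulrDl !mulrDr tt tV bV o3 add0r addr0.
have recover t : t \in corner p :\ 0 -> p * (t + bar t ^+ N.+1) = t.
  case/setD1P=> _ /cornerP pt.
  have bpt : bar p * bar t = bar t by rewrite -rmorphM pt.
  by rewrite mulrDr pt exprS mulrA -bpt mulrA pbp !mul0r addr0.
by move=> /recover xE /recover yE E; rewrite -xE -yE E.
Qed.

End UnitaryGroup.

(** [(1 + x) ^+ n * (1 - x) ^+ n] is at most 1, and Bernoulli's inequality puts the second factor
    above one half. *)
Lemma expr1D_lt2 (R : realFieldType) (n : nat) (x : R) :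
  0 <= x -> n%:R * x < 2^-1 -> (1 + x) ^+ n < 2.
Proof.
move=> x0; case: n => [|n] nx; first by rewrite expr0 ltr1n.
have n1 : 1 <= n.+1%:R :> R by rewrite ler1n.
have x1 : x < 2^-1 by nra.
have bern (k : nat) : 1 - k%:R * x <= (1 - x) ^+ k.
  elim: k => [|k IH]; first by rewrite mul0r subr0 expr0.
  rewrite exprS -natr1; have k0 : 0 <= k%:R :> R by [].
  by nra.
have le1 : (1 + x) ^+ n.+1 * (1 - x) ^+ n.+1 <= 1.
  by rewrite -exprMn exprn_ile1 //; nra.
have g0 : 0 < (1 + x) ^+ n.+1 by apply: exprn_gt0; lra.
by have := bern n.+1; nra.
Qed.

(** * The union bound over idempotents *)

Section GoodUnitary.
Variables (A : finComNzRingType) (bar : {rmorphism A -> A}) (N : nat).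
Hypothesis barK : involutive bar.
Hypothesis expr_periodic : forall x : A, x ^+ N.+3 = x.
Implicit Types e f p x : A.

Lemma card_corner_unitary f : idem f -> bar f = f ->
    (forall p, atom p -> f * p = p -> (2 < #|corner p|)%N /\
       (bar p = p -> exists2 x, x \in corner p & bar x != x)) ->
  (#|corner f| <= #|unitary bar f| ^ 4)%N.
Proof.
have [m] := ubnP #|corner f|; elim: m f => // m IH f fm jf bf hat.
have [f0|f0] := eqVneq f 0.
  have -> : #|corner f| = 1%N.
    by apply: (@eq_card1 _ 0) => x; rewrite !inE f0 mul0r eq_sym.
  by rewrite expn_gt0; apply/orP; left; apply/card_gt0P; exists 0;
    rewrite !inE f0 mulr0 mul0r eqxx.
have [p ap fp] := exists_atom jf f0; have [p0 pp pdich] := atomP _ ap.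
have [c2 self] := hat p ap fp.
have step g : idem g -> bar g = g -> g * p = p -> f * g = g ->
    (#|corner g| <= #|unitary bar g| ^ 4)%N ->
      (#|corner f| <= #|unitary bar f| ^ 4)%N.
  move=> ig bg gp fg cg.
  have jfg : idem (f - g) by apply: idemB.
  have gfg : g * (f - g) = 0 by rewrite mulrBr (eqP ig) mulrC fg subrr.
  have bfg : bar (f - g) = f - g by rewrite rmorphB bf bg.
  have Ef : g + (f - g) = f by rewrite addrC subrK.
  have cf := card_cornerD ig jfg gfg; have uf := card_unitaryD gfg bg bfg.
  rewrite Ef in cf uf; rewrite cf.
  have cg2 : (1 < #|corner g|)%N.
    by apply: leq_trans (subset_leq_card (corner_sub gp)); apply: ltnW.
  have cfg : (#|corner (f - g)%R| <= #|unitary bar (f - g)%R| ^ 4)%N.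
    apply: IH => //.
      rewrite -ltnS; apply: leq_trans fm; rewrite cf;
        move: (corner_gt0 (f - g)) cg2.
      by move: #|_| #|_| => a b a0 b1;
        rewrite ltnS -[X in (X < _)%N]mul1n ltn_pmul2r.
    move=> q aq fgq; apply: hat => //.
    by rewrite -fgq mulrA mulrBr (eqP jf) fg.
  apply: leq_trans (leq_mul cg cfg) _.
  by rewrite -expnMn leq_exp2r.
have abp := atom_bar barK ap; have [bp0 bpp bpdich] := atomP _ abp.
have ibp := atom_idem abp; have ip := atom_idem ap.
have fbp : f * bar p = bar p by rewrite -bf -rmorphM fp.
have [pbp|pbp] := pdich _ ibp.
  apply: (step (p + bar p)).
  - exact: idemD.
  - by rewrite rmorphD barK addrC.
  - by rewrite mulrDl pp [bar p * p]mulrC pbp addr0.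
  - by rewrite mulrDr fp fbp.
  - exact: (card_corner_split barK expr_periodic).
have bp : bar p = p.
  case: (bpdich _ ip) => h; last by rewrite -h mulrC.
  by case/eqP: p0; rewrite -pbp mulrC.
apply: (step p) => //.
apply: leq_trans (card_corner_self barK expr_periodic ap bp (self bp)) _.
rewrite leq_pexp2l //; apply/card_gt0P; exists p.
by rewrite !inE bp pp eqxx.
Qed.

(** Abstract form of the group algebra: [d] is the dimension of the ideal of an idempotent, [e0] the
    trivial idempotent, [low] the set of words of low weight, and [a] the base in which all counts
    are expressed. *)
Variables (R : realFieldType) (a : R) (q n mu : nat) (d : A -> nat).
Variables (e0 : A) (low : {set A}).
Hypotheses (q_gt1 : (1 < q)%N) (n_gt2 : (2 < n)%N) (a_gt1 : 1 < a).
Hypotheses (a_q : a ^+ 48 <= q%:R) (n_mu : n%:R <= a ^+ mu).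
Hypothesis card_corner : forall e, idem e -> #|corner e| = (q ^ d e)%N.
Hypothesis d1 : d 1 = n.
Hypotheses (ie0 : idem e0) (be0 : bar e0 = e0) (de0 : d e0 = 1%N).
Hypothesis low_card : forall e, idem e ->
  #|corner e :&: low|%:R <= n%:R * a ^+ (2 * d e).
Hypothesis low_trivial : forall u, u \in corner e0 -> u \in low -> u = 0.
Hypothesis atoms : forall p, atom p -> p * e0 = 0 ->
  [/\ (mu <= d p)%N, (2 < #|corner p|)%N
    & bar p = p -> exists2 x, x \in corner p & bar x != x].

Let cofactor0 e : (1 - e0) * e = e -> e * e0 = 0.
Proof.
by move=> <-; rewrite mulrC mulrA mulrBr mulr1 (eqP ie0) subrr mul0r.
Qed.

Lemma d_D e f : idem e -> idem f -> e * f = 0 -> d (e + f) = (d e + d f)%N.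
Proof.
move=> ie jf ef; apply/eqP; rewrite -(eqn_exp2l _ _ q_gt1) expnD.
by rewrite -!card_corner ?card_cornerD //; apply: idemD.
Qed.

Lemma mu_le_d e : idem e -> e != 0 -> (1 - e0) * e = e -> (mu <= d e)%N.
Proof.
move=> ie en0 ee; have [p ap ep] := exists_atom ie en0.
have [mup _ _] : [/\ (mu <= d p)%N, (2 < #|corner p|)%N
    & bar p = p -> exists2 x, x \in corner p & bar x != x].
  by apply: atoms => //; apply: cofactor0; rewrite -ep mulrA ee.
apply: leq_trans mup _; rewrite -(leq_exp2l _ _ q_gt1).
by rewrite -!card_corner ?(atom_idem ap) // subset_leq_card // corner_sub.
Qed.

Lemma mu_expn_gt0 : (0 < mu)%N.
Proof.
by rewrite lt0n; apply: contraTneq n_mu => ->; rewrite -ltNge expr0 ltr1n ltnW.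
Qed.

(* [S] is the set of bad [c], with a witness [g c] generating the ideal of [e]
   up to the trivial component. As [48 = 4 * 12], the unitary group of
   [e + bar e - e * bar e] has at least [a ^+ (12 * d e)] elements, while there
   are at most [a ^+ (10 * d e)] pairs [(g c, g c * c)]. *)
Lemma card_bad_le e (S : {set A}) (g : A -> A) :
    idem e -> e != 0 -> (1 - e0) * e = e -> S \subset unitary bar 1 ->
    {in S, forall c, [/\ g c \in low, g c * c \in low
                       & (1 - e0) * g c ^+ N.+2 = e]} ->
  #|S|%:R <= #|unitary bar 1|%:R * a ^- (2 * d e).
Proof.
move=> ie en0 ee SU Sg.
pose f := e + bar e - e * bar e.
pose st := #|[set c in unitary bar 1 | (e * c == e)%R]|.
pose l := #|corner (e + e0) :&: low|.
have eo : e * e0 = 0 by apply: cofactor0.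
have iee0 : idem (e + e0) by apply: idemD.
have gin c : c \in S -> (e + e0) * g c = g c.
  move=> cS; have [_ _ h] := Sg c cS.
  have E : (e + e0) * g c ^+ N.+2 = g c ^+ N.+2 + e0 * e.
    rewrite mulrDl; have -> : e * g c ^+ N.+2 = e.
      by rewrite -[in LHS]h -mulrA (eqP (support_idem expr_periodic _)).
    by rewrite -h; have /eqP := ie0; move: (g c ^+ _) => z ez;
      rewrite (mulrA e0) mulrBr mulr1 ez subrr mul0r addr0 mulrBl mul1r subrK.
  rewrite -{1}(support_mul expr_periodic (g c)) mulrA E (mulrC e0) eo addr0.
  by rewrite (support_mul expr_periodic).
(* Two elements of a fibre differ by a unitary factor fixing [g c], hence fixing [e], which is a
   multiple of [g c]. *)
have S_le : (#|S| <= l * l * st)%N.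
  rewrite -cardsX; apply: (@card_fiber_le _ _ _ _ (fun c => (g c, g c * c))).
    move=> c cS; have [lg lgc _] := Sg c cS; have gc := gin c cS.
    by rewrite in_setX /= !inE lg lgc mulrA gc !eqxx.
  move=> c cS; have [_ _ gce] := Sg c cS.
  have /unitary1P cc := subsetP SU _ cS.
  rewrite -(@card_in_imset _ _ ( *%R^~ (bar c))); last first.
    move=> x y _ _ /(congr1 ( *%R^~ c)).
    by rewrite /= -!mulrA (mulrC _ c) cc !mulr1.
  apply/subset_leq_card/subsetP => z /imsetP[y yS ->{z}].
  move: yS; rewrite inE => /andP[yS /eqP[gyc gyy]].
  have /unitary1P yy := subsetP SU _ yS.
  rewrite inE; apply/andP; split.
    by apply/unitary1P; rewrite rmorphM barK mulrACA yy mul1r mulrC cc.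
  rewrite gyc in gyy.
  have E : g c * (y * bar c) = g c by rewrite mulrA gyy -mulrA cc mulr1.
  by rewrite -gce -mulrA exprSr -mulrA E.
(* The factor [n] costs [mu <= d e] in the exponent, and the trivial component costs
   [2 <= 2 * d e]. *)
have l_le : l%:R <= a ^+ (5 * d e).
  apply: le_trans (low_card iee0) _; rewrite d_D // de0.
  have mude := mu_le_d ie en0 ee; have mu0 := mu_expn_gt0.
  apply: (@le_trans _ _ (a ^+ mu * a ^+ (2 * (d e + 1)))).
    by rewrite ler_wpM2r // exprn_ge0 // ltW // (lt_trans ltr01).
  by rewrite -exprD ler_weXn2l ?ltW //; lia.
have bf : bar f = f by rewrite /f rmorphB rmorphD rmorphM barK (addrC e) (mulrC e).
have ibe := idem_bar bar ie.
have fe : f * e = e.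
  by rewrite /f mulrBl mulrDl (eqP ie) mulrAC (eqP ie) [bar e * e]mulrC addrK.
have jf : idem f.
  have -> : f = e + (1 - e) * bar e by rewrite /f mulrBl mul1r addrA.
  apply: idemD => //.
    by apply: idemM => //; apply: idemB; rewrite ?mul1r //; apply: idem1.
  by rewrite mulrA mulrBr mulr1 (eqP ie) subrr mul0r.
have bee : (1 - e0) * bar e = bar e
  by rewrite -[in RHS]ee rmorphM rmorphB rmorph1 be0.
have ff : (1 - e0) * f = f.
  by rewrite /f mulrBr mulrDr ee bee mulrA ee.
have := unitary_stab_le barK ie (erefl f); rewrite -/st.
have : (#|corner f| <= #|unitary bar f| ^ 4)%N.
  apply: card_corner_unitary => // p ap fp.
  have [|_ ? ?] := atoms ap; last by split.
  by apply: cofactor0; rewrite -fp mulrA ff.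
have : (q ^ d e <= #|corner f|)%N.
  by rewrite -card_corner // subset_leq_card // corner_sub.
move: S_le; set s := #|S|; set u := #|unitary bar f|; set U := #|unitary bar 1|.
move=> S_le qf fu stu.
have a0 : 0 < a by apply: lt_trans a_gt1.
have u_le : a ^+ (12 * d e) <= u%:R.
  rewrite -(@ler_pXn2r _ 4) ?nnegrE ?ler0n ?exprn_ge0 ?(ltW a0) //.
  rewrite -exprM -natrX; apply: (@le_trans _ _ ((q ^ d e)%N%:R)).
    have -> : (12 * d e * 4 = 48 * d e)%N by rewrite mulnAC.
    by rewrite exprM natrX lerXn2r ?nnegrE ?exprn_ge0 ?(ltW a0).
  by rewrite ler_nat (leq_trans qf).
have E : a ^+ (12 * d e) = a ^+ (5 * d e) * a ^+ (5 * d e) * a ^+ (2 * d e).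
  by rewrite -!exprD -!mulnDl.
have p2 : 0 < a ^+ (2 * d e) by apply: exprn_gt0.
have p5 : 0 < a ^+ (5 * d e) by apply: exprn_gt0.
rewrite ler_pdivlMr //.
have H1 : s%:R <= l%:R * l%:R * st%:R :> R by rewrite -!natrM ler_nat.
have H2 : st%:R * u%:R <= U%:R :> R by rewrite -natrM ler_nat.
apply: le_trans H2; apply: (@le_trans _ _ (st%:R * a ^+ (12 * d e))); last first.
  by rewrite ler_wpM2l.
rewrite E mulrA; apply: ler_wpM2r; first exact: ltW.
apply: (le_trans H1); rewrite mulrC.
by apply: ler_wpM2l => //; apply: ler_pM.
Qed.

(** Were every unitary [c] bad, sorting them by the non-trivial support [h c] of a witness would
    make the sum of [a ^- (2 * d e)] over the nonzero idempotents [e] of the non-trivial part at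
    least 1. With the term 1 of [e = 0] the total would reach 2, but it is smaller. *)
Theorem exists_good_unitary : exists2 c, c * bar c = 1 &
  forall u, u \in low -> u * c \in low -> u = 0.
Proof.
have [/existsP[c /andP[/unitary1P cc /forallP h]]|] := boolP [exists c,
    (c \in unitary bar 1) &&
      [forall u, (u \in low) && (u * c \in low) ==> (u == 0)]].
  by exists c => // u ul ucl; apply/eqP; have := h u; rewrite ul ucl.
move=> /existsPn bad; exfalso.
have {}bad c : {u | c \in unitary bar 1 -> [/\ u \in low, u * c \in low & u != 0]}.
  case: (pickP [pred u | [&& u \in low,
    u * c \in low & u != 0]]) => [u /and3P[? ? ?]|h].
    by exists u.
  exists 0 => cU; case/negP: (bad c); rewrite cU /=.
  apply/forallP => u; apply/implyP => /andP[ul ucl].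
  by have := h u; rewrite /= ul ucl /= => /negbFE.
pose g c := sval (bad c).
have gP c : c \in unitary bar 1 -> [/\ g c \in low, g c * c \in low & g c != 0].
  exact: (svalP (bad c)).
pose h c := (1 - e0) * g c ^+ N.+2.
have i1e0 : idem (1 - e0) by apply: idemB; rewrite ?mul1r //; apply: idem1.
have hP c : c \in unitary bar 1 -> [/\ idem (h c), (1 - e0) * h c = h c & h c != 0].
  move=> cU; split.
  - by apply: idemM => //; apply: support_idem.
  - by rewrite /h mulrA (eqP i1e0).
  (* A witness with [h c = 0] would lie in the trivial component, where [low] contains only 0. *)
  have [lg _] := gP c cU; apply: contra_neq => hc0; apply: low_trivial => //.
  apply/cornerP; rewrite -{2}(support_mul expr_periodic (g c)).
  move/eqP: hc0; rewrite /h mulrBl mul1r subr_eq0 => /eqP ->.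
  by rewrite -mulrA (support_mul expr_periodic).
pose E := [pred e | idem e && ((1 - e0) * e == e)].
have a0 : 0 < a by apply: lt_trans a_gt1.
have tot : \sum_(e | E e) a ^- (2 * d e) <= (1 + (n%:R ^- 2)) ^+ n.
  have d0 : d 0 = 0%N.
    by have := d_D (idem0 A) (idem0 A) (mulr0 _); rewrite addr0; lia.
  apply: (@sum_idem_le _ _ _ _ q) => //.
  - by rewrite invr_ge0 exprn_ge0.
  - by move=> e; rewrite invr_ge0 exprn_ge0 // ltW.
  - by rewrite d0 muln0 expr0 invr1.
  - by move=> e e' ie ie' ee'; rewrite d_D // mulnDr exprD invfM.
  - by rewrite -d1 -card_corner ?idem1 // subset_leq_card // corner_sub // mul1r.
  move=> p ap pe; have [mup c2 _] := atoms ap (cofactor0 pe).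
  have mu0 := mu_expn_gt0.
  split.
    rewrite card_corner ?(atom_idem ap) // -{1}(expn1 q) leq_exp2l //.
    exact: leq_trans mup.
  (* An atom weighs at most [n ^- 2], by [n <= a ^+ mu] and [mu <= d p]. *)
  rewrite lef_pV2 ?posrE ?exprn_gt0 ?ltr0n ?(leq_trans _ n_gt2) //.
  apply: (@le_trans _ _ ((a ^+ mu) ^+ 2));
    first by rewrite lerXn2r ?nnegrE ?exprn_ge0 ?(ltW a0).
  by rewrite -exprM mulnC ler_weXn2l ?(ltW a_gt1) // leq_mul2l mup.
have : (1 + (n%:R ^- 2)) ^+ n < 2 :> R.
  have n0 : 3 <= n%:R :> R by rewrite (ler_nat R 3).
  apply: expr1D_lt2; first by rewrite invr_ge0 exprn_ge0.
  have ni : n%:R * n%:R^-1 = 1 :> R by rewrite mulfV // gt_eqF //; lra.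
  by rewrite -exprVn; move: (n%:R^-1) ni => y; nra.
apply/negP; rewrite -leNgt; apply: le_trans tot.
have U0 : 0 < #|unitary bar 1|%:R :> R.
  by rewrite ltr0n; apply/card_gt0P; exists 1; apply/unitary1P;
    rewrite rmorph1 mulr1.
rewrite (bigD1 0) /=; last by rewrite idem0 mulr0 eqxx.
have -> : d 0 = 0%N by have := d_D (idem0 A) (idem0 A) (mulr0 _);
  rewrite addr0; lia.
rewrite muln0 expr0 invr1 -[2]/(1 + 1) lerD2l.
rewrite -(ler_pM2l U0) mulr1 mulr_sumr.
rewrite -[X in X%:R <= _]sum1_card (partition_big h (fun e =>
  E e && (e != 0))) /=; last first.
  by move=> c /hP[-> -> ->]; rewrite eqxx.
rewrite natr_sum; apply: ler_sum => e /andP[/andP[ie /eqP ee] en0].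
rewrite sum1_card -cardsE.
apply: (@card_bad_le _ _ g) => //.
  by apply/subsetP => c; rewrite inE => /andP[].
by move=> c; rewrite inE => /andP[/gP[? ? _] /eqP].
Qed.

End GoodUnitary.

(** Fermat's little theorem in the field [corner p]: multiplication by [x] permutes the nonzero
    elements, whose product is invertible. *)
Lemma atom_expr_card (A : finComNzRingType) (N : nat) (p x : A) :
    (forall y : A, y ^+ N.+3 = y) -> atom p -> x \in corner p -> x != 0 ->
  x ^+ #|corner p|.-1 = p.
Proof.
move=> per ap xp x0; have [p0 pp _] := atomP _ ap.
pose K := corner p :\ 0.
have cK : #|corner p| = #|K|.+1 by rewrite (cardsD1 0 (corner p)) inE mulr0 eqxx.
have KP y : y \in K -> y \in corner p /\ y != 0 by case/setD1P.
have pK : p \in K by rewrite !inE p0 pp eqxx.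
have K0 : (0 < #|K|)%N by apply/card_gt0P; exists p.
have expp k : (0 < k)%N -> p ^+ k = p.
  by case: k => // k _; elim: k => // k IH; rewrite exprS IH pp.
rewrite cK /=.
have px : p * x ^+ #|K| = x ^+ #|K|.
  by rewrite -(prednK K0) exprS mulrA (cornerP _ _ xp).
have stable y : y \in K -> x * y \in K.
  case/KP => yp y0; rewrite in_setD1; apply/andP; split; last first.
    by apply/cornerP; rewrite mulrA (cornerP _ _ xp).
  apply: contra_neq y0 => h; apply: (atom_mulI per ap xp x0) => //.
    by rewrite inE mulr0.
  by rewrite mulrC h mul0r.
have injx : {in K &, injective ( *%R x)}.
  move=> y z /KP[yp _] /KP[zp _] E; apply: (atom_mulI per ap xp x0) => //.
  by rewrite mulrC E mulrC.
have imK : [set x * y | y in K] = K.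
  apply/eqP; rewrite eqEcard card_in_imset // leqnn andbT.
  by apply/subsetP => _ /imsetP[y yK ->]; apply: stable.
have prodE : x ^+ #|K| * \prod_(y in K) y = \prod_(y in K) y.
  by rewrite -[in RHS]imK big_imset //= big_split prodr_const.
have inv : (\prod_(y in K) y) * (\prod_(y in K) y ^+ N.+1) = p.
  rewrite -big_split /= (eq_bigr (fun=> p)) ?prodr_const ?expp // => y /KP[yp y0].
  by rewrite -exprS (atom_expr per ap yp y0).
by rewrite -px -inv mulrC mulrA prodE.
Qed.

(** * Counting words of low weight *)

Section WordCount.
Variables (R : realFieldType) (a : R) (L : nat) (F : finFieldType) (S : finType).
Hypotheses (a_ge1 : 1 <= a) (a_L : #|F|%:R <= (a - 1) * a ^+ L).

Definition word_weight (w : {ffun S -> F}) := #|[set s | w s != 0]|.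

(** Exponential moment bound: each nonzero coordinate contributes a factor [a ^- L]. The factors
    over all letters sum to at most [a] by [a_L], so all words together total at most [a ^+ #|S|],
    while a low word contributes at least [a ^- #|S|]. *)
Lemma card_low_words :
  #|[set w : {ffun S -> F} | (L * word_weight w <= #|S|)%N]|%:R
    <= a ^+ (2 * #|S|).
Proof.
have a0 : 0 < a by apply: lt_le_trans a_ge1.
pose t (c : F) : R := if c == 0 then 1 else a ^- L.
have tw (w : {ffun S -> F}) : \prod_(s : S) t (w s) = a ^- (L * word_weight w).
  rewrite (bigID (fun s => w s == 0)) /= big1 ?mul1r; last by move=> s;
    rewrite /t => ->.
  rewrite (eq_bigr (fun=> a ^- L)); last by move=> s /negPf; rewrite /t => ->.
  by rewrite prodr_const exprVn exprM /word_weight cardsE.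
have t0 c : 0 <= t c by rewrite /t; case: ifP => // _;
  rewrite invr_ge0 exprn_ge0 // ltW.
have sumt : \sum_c t c <= a.
  rewrite (bigD1 0) //= /t eqxx (eq_bigr (fun=> a ^- L));
    last by move=> c /negPf ->.
  rewrite sumr_const -lerBrDl -mulr_natr mulrC ler_pdivrMr ?exprn_gt0 //.
  by apply: le_trans a_L; rewrite ler_nat max_card.
apply: (@le_trans _ _ (a ^+ #|S| * \sum_(w : {ffun S -> F}) \prod_s t (w s))).
  rewrite -sum1_card natr_sum mulr_sumr big_mkcond /=; apply: ler_sum => w _.
  have := tw w; case: ifP => [|_] h;
    last by rewrite mulr_ge0 ?exprn_ge0 ?prodr_ge0 // ltW.
  move=> ->; rewrite inE in h; rewrite ler_pdivlMr ?exprn_gt0 // mul1r.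
  by rewrite ler_weXn2l.
rewrite -(bigA_distr_bigA (fun _ => t)) prodr_const mul2n -addnn exprD.
by rewrite ler_pM2l ?exprn_gt0 // lerXn2r ?nnegrE ?sumr_ge0 // ltW.
Qed.

End WordCount.

(** * The group algebra of an abelian group, its involution and its ideals *)

Section AbelianGroupAlgebra.
Variables (F : finFieldType) (gT : finGroupType).

(* The commutativity proof is a parameter of this copy, so that the structure
   of commutative ring can be inferred. *)
Definition abelian_algebra of abelian [set: gT] : Type := group_algebra F gT.

Variable ab : abelian [set: gT].
Local Notation A := (abelian_algebra ab).
Local Notation FG := (group_algebra F gT).
Local Notation q := #|F|.
Local Notation n := #|gT|.

HB.instance Definition _ := Finite.copy A FG.
HB.instance Definition _ := GRing.Algebra.copy A FG.

Lemma abelian_mulgC (x y : gT) : (x * y = y * x)%g.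
Proof. by apply: (centsP ab); rewrite inE. Qed.

Fact abelian_algebra_mulC : commutative (@GRing.mul A).
Proof.
move=> u v; apply: ga_eqP => z; rewrite !coef_mul.
rewrite (reindex_inj (inj_comp (mulgI z) invg_inj)) /=; apply: eq_bigr => x _.
by rewrite invMg invgK mulgKV mulrC (abelian_mulgC z).
Qed.

HB.instance Definition _ :=
  GRing.PzRing_hasCommutativeMul.Build A abelian_algebra_mulC.

End AbelianGroupAlgebra.

Section GroupAlgebraIdeals.
Variables (F : finFieldType) (gT : finGroupType) (ab : abelian [set: gT]).
Local Notation A := (abelian_algebra F ab).
Local Notation q := #|F|.
Local Notation n := #|gT|.
Implicit Types (u v e p : A) (g h x : gT).

Lemma acoefP u v : coef u =1 coef v -> u = v.
Proof. exact: (@ga_eqP F gT). Qed.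

Lemma acoefD u v x : coef (u + v) x = coef u x + coef v x.
Proof. exact: (@Defs.coefD F gT u v x). Qed.

Lemma acoefZ k u x : coef (k *: u) x = k * coef u x.
Proof. exact: (@Defs.coefZ F gT k u x). Qed.

Lemma acoef0 x : coef (0 : A) x = 0.
Proof. exact: (@Defs.coef0 F gT x). Qed.

Lemma acoef1 x : coef (1 : A) x = (x == 1%g)%:R.
Proof. exact: (@coef_one F gT x). Qed.

Lemma acoefM u v z : coef (u * v) z = \sum_x coef u x * coef v (x^-1 * z)%g.
Proof. exact: (@coef_mul F gT u v z). Qed.

Lemma acoefN u x : coef (- u) x = - coef u x.
Proof. by rewrite -scaleN1r acoefZ mulN1r. Qed.

Lemma acoef_sum (I : Type) (r : seq I) (P : pred I) (E : I -> A) x :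
  coef (\sum_(i <- r | P i) E i) x = \sum_(i <- r | P i) coef (E i) x.
Proof.
by apply: (big_morph (fun u => coef u x)) => [u v|]; [exact: acoefD|exact: acoef0].
Qed.

(* [coef_surj] is opaque, so that [dirac 1] and [1] do not unify. *)
Fact coef_surj (c : gT -> F) : {v : A | coef v =1 c}.
Proof. by exists ([ffun x => (c x : F^o)] : group_algebra F gT) => x;
  apply: ffunE. Qed.

Definition dirac g : A := sval (coef_surj (fun x => (x == g)%:R)).

Lemma coef_dirac g x : coef (dirac g) x = (x == g)%:R.
Proof. exact: (svalP (coef_surj _)). Qed.

Lemma coef_diracM g u x : coef (dirac g * u) x = coef u (g^-1 * x)%g.
Proof.
rewrite acoefM (bigD1 g) //= big1 ?addr0 ?coef_dirac ?eqxx ?mul1r // => y /negPf yg.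
by rewrite coef_dirac yg mul0r.
Qed.

Lemma dirac1 : dirac 1%g = 1.
Proof. by apply: acoefP => x; rewrite coef_dirac acoef1. Qed.

Lemma diracM g h : dirac (g * h)%g = dirac g * dirac h.
Proof.
by apply: acoefP => x;
  rewrite coef_diracM !coef_dirac -(inj_eq (mulgI g^-1%g)) mulKg.
Qed.

Lemma diracX g k : dirac (g ^+ k)%g = dirac g ^+ k.
Proof. by elim: k => [|k IH]; rewrite ?dirac1 // expgS exprS diracM IH. Qed.

Lemma dirac_sum u : u = \sum_g coef u g *: dirac g.
Proof.
apply: acoefP => x; rewrite acoef_sum (bigD1 x) //= big1 => [|g /negPf gx].
  by rewrite acoefZ coef_dirac eqxx mulr1 addr0.
by rewrite acoefZ coef_dirac eq_sym gx mulr0.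
Qed.

Definition bar u : A := sval (coef_surj (fun x => coef u x^-1%g)).

Lemma coef_bar u x : coef (bar u) x = coef u x^-1%g.
Proof. exact: (svalP (coef_surj _)). Qed.

Fact bar_is_zmod_morphism : zmod_morphism bar.
Proof.
by move=> u v; apply: acoefP => x; rewrite !(coef_bar, acoefD, acoefN).
Qed.

Fact bar_is_monoid_morphism : monoid_morphism bar.
Proof.
split=> [|u v]; apply: acoefP => x; first by rewrite coef_bar !acoef1 invg_eq1.
rewrite coef_bar !acoefM (reindex_inj invg_inj); apply: eq_bigr => y _ /=.
by rewrite !coef_bar !invgK invMg invgK (abelian_mulgC ab).
Qed.

HB.instance Definition _ := GRing.isZmodMorphism.Build A A bar bar_is_zmod_morphism.
HB.instance Definition _ := GRing.isMonoidMorphism.Build A A bar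
  bar_is_monoid_morphism.

Lemma barK : involutive bar.
Proof. by move=> u; apply: acoefP => x; rewrite !coef_bar invgK. Qed.

Lemma bar_dirac g : bar (dirac g) = dirac g^-1%g.
Proof. by apply: acoefP => x; rewrite coef_bar !coef_dirac eqg_invLR. Qed.

(** [q] is a power of the characteristic, so raising to the power [q] is additive, and it fixes the
    coefficients. *)
Lemma frobenius u k : u ^+ (q ^ k) = \sum_g coef u g *: dirac (g ^+ (q ^ k))%g.
Proof.
elim: k => [|k IH]; first by rewrite expn0 expr1 {1}(dirac_sum u).
have [r r_pr rF] := finPcharP F.
have rA : r \in [pchar A].
  rewrite inE r_pr /=; have /andP[_ /eqP rF0] := rF.
  by rewrite -[1]scale1r -scaler_nat scalerA mulr1 rF0 scale0r.
have qA : [pchar A].-nat q.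
  by have := card_pprimeChar rF; rewrite [#|_|]/= => ->; rewrite pnatX pnatE // rA.
rewrite expnS mulnC exprM IH.
have q0 : (0 < q)%N by apply: ltnW; exact: finNzRing_gt1.
have powD : {morph (fun v : A => v ^+ q) : v w / v + w} by move=> v w;
  apply: exprDn_pchar.
rewrite (big_morph (fun v : A => v ^+ q) powD (id1 := 0)) /=; last first.
  by rewrite expr0n gtn_eqF.
apply: eq_bigr => g _; rewrite exprZn expf_card -diracX -expgM.
by congr (GRing.scale _ (dirac (natexp _ _))).
Qed.

Lemma group_algebra_periodic : coprime n q ->
  exists N, forall u, u ^+ N.+3 = u.
Proof.
(* Euler's theorem gives [g ^+ (q ^ k) = g] for every group element; the factor 2 makes [q ^ k]
   large enough to have the form [N.+3]. *)
move=> nq; pose k := (totient n * 2)%N.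
have n0 : (0 < n)%N by apply/card_gt0P; exists 1%g.
have tn : (0 < totient n)%N by rewrite totient_gt0.
have tk : (1 < k)%N by rewrite /k; move: tn; clear; lia.
have qk : (3 < q ^ k)%N.
  apply: (@leq_trans (2 ^ 2)); first by [].
  apply: (@leq_trans (q ^ 2)); first by rewrite leq_exp2r // finNzRing_gt1.
  by rewrite leq_pexp2l // ltnW // finNzRing_gt1.
exists (q ^ k - 3)%N => u; rewrite -addn3 subnK 1?ltnW // frobenius [RHS]dirac_sum.
apply: eq_bigr => g _; congr (_ *: dirac _).
have gn : (g ^+ n = 1)%g by rewrite -cardsT expg_cardG ?inE.
have qk1 : (q ^ k = 1 %[mod n])%N.
  have qt : (q ^ totient n = 1 %[mod n])%N by apply: Euler_exp_totient;
    rewrite coprime_sym.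
  by rewrite /k expnM -modnXm qt modnXm exp1n.
by rewrite -(expg_mod _ gn) qk1 (expg_mod _ gn) expg1.
Qed.

Lemma diracK g u : dirac g^-1%g * (dirac g * u) = u.
Proof. by rewrite mulrA -diracM mulVg dirac1 mul1r. Qed.

Section Subspace.
Variable I : {set A}.
Hypotheses (I0 : 0 \in I) (I_lin : forall (k : F) u v,
  u \in I -> v \in I -> k *: u + v \in I).

(** The restriction to [T] of the translate of [u] by the inverse of [g]. *)
Let restr (T : {set gT}) (g : gT) u : {ffun {x : gT | x \in T} -> F} :=
  [ffun s => coef u (g * val s)%g].

Let IB u v : u \in I -> v \in I -> u - v \in I.
Proof. by move=> uI vI; rewrite addrC -scaleN1r I_lin. Qed.

(** [T] is a smallest set of positions that determines the elements of [I]. By minimality each [t]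
    in [T] has an element of [I] equal to 1 at [t] and to 0 on the rest of [T], so restriction to
    [T] is onto as well. *)
Lemma information_set : exists T : {set gT},
  [/\ #|I| = (q ^ #|T|)%N
    & {in I, forall u, (forall x, x \in T -> coef u x = 0) -> u = 0}].
Proof.
pose P (T : {set gT}) := [forall u in I, [forall x in T,
  coef u x == 0] ==> (u == 0)].
have PP (T : {set gT}) : reflect {in I, forall u, (forall x,
  x \in T -> coef u x = 0) -> u = 0} (P T).
  apply: (iffP forall_inP) => H u uI.
    move=> h; apply/eqP; have /implyP := H u uI; apply.
    by apply/forall_inP => x /h ->.
  apply/implyP => /forall_inP h; apply/eqP; apply: H => // x /h /eqP //.
have PT : P [set: gT].
  apply/PP => u _ h; apply: acoefP => x; rewrite acoef0; apply: h.
  by rewrite inE.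
case: (arg_minnP (fun T : {set gT} => #|T|) PT) => T /PP T_inj T_min.
exists T; split=> //.
have dual t : {v | t \in T -> v \in I /\ forall x,
  x \in T -> coef v x = (x == t)%:R}.
  pose Q v := (v \in I) && [forall x in T, coef v x == (x == t)%:R].
  case: (pickP Q) => [v /andP[vI /forall_inP h]|noQ].
    by exists v => _; split=> // x /h /eqP.
  exists 0 => tT; exfalso.
  suff /T_min : P (T :\ t) by rewrite (cardsD1 t T) tT ltnn.
  apply/PP => u uI h; apply: T_inj => // x xT.
  have [->{x xT}|xt] := eqVneq x t; last by apply: h; rewrite in_setD1 xt.
  apply: contraFeq (noQ ((coef u t)^-1 *: u)) => ut.
  rewrite /Q -[_ *: u]addr0 I_lin //=; apply/forall_inP => x xT;
    rewrite addr0 acoefZ.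
  have [->|xt] := eqVneq x t; first by rewrite mulVf.
  by rewrite (h x) ?in_setD1 ?xt ?xT // mulr0 mulr0n eqxx.
rewrite -(card_sig (mem T)) -card_ffun.
rewrite -(@card_in_imset _ _ (restr T 1%g)) => [|u v uI vI /ffunP E].
  apply: eq_card => w; rewrite !inE; apply/imsetP.
  pose u := \sum_(s : {x : gT | x \in T}) w s *: sval (dual (val s)).
  have uI : u \in I.
    apply: (big_rec (fun u => u \in I)) => // s v _ vI; apply: I_lin => //.
    by case: (svalP (dual (val s)) (valP s)).
  exists u => //; apply/ffunP => s;
    rewrite ffunE mul1g acoef_sum (bigD1 s) //= big1.
    have [_ E] := svalP (dual (val s)) (valP s).
    by rewrite acoefZ E ?(valP s) // eqxx mulr1 addr0.
  move=> t ts; have [_ E] := svalP (dual (val t)) (valP t).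
  by rewrite acoefZ E ?(valP s) // (inj_eq val_inj) eq_sym (negPf ts) mulr0.
apply/eqP; rewrite -subr_eq0; apply/eqP; apply: T_inj; first exact: IB.
move=> x xT; have := E (Sub x xT); rewrite !ffunE SubK mul1g => h.
by rewrite acoefD acoefN h subrr.
Qed.

Definition weight u := #|[set x | coef u x != 0]|.

Variables (R : realFieldType) (a : R) (L : nat).
Hypotheses (a_ge1 : 1 <= a) (a_L : #|F|%:R <= (a - 1) * a ^+ L).
Hypothesis I_dirac : forall g u, u \in I -> dirac g * u \in I.

(* Some translate of an information set meets the support of [u] in at most
   the average number of points. *)
Lemma card_low_ideal d : #|I| = (q ^ d)%N ->
  #|I :&: [set u | (L * weight u <= n)%N]|%:R <= n%:R * a ^+ (2 * d).
Proof.
have n0 : (0 < n)%N by apply/card_gt0P; exists 1%g.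
have [T [cI T_inj]] := information_set; rewrite cI => /eqP.
rewrite eqn_exp2l ?finNzRing_gt1 // => /eqP <-.
have cT : #|{: {x : gT | x \in T}}| = #|T| by rewrite card_sig.
have trans u : (\sum_g word_weight (restr T g u) = #|T| * weight u)%N.
  transitivity (\sum_g \sum_(s : {x : gT | x \in T}) (coef u (g * val s)%g !=
    0%R))%N.
    apply: eq_bigr => g _; rewrite /word_weight -sum1_card big_mkcond /=.
    by apply: eq_bigr => s _; rewrite inE ffunE; case: eqP.
  rewrite exchange_big -cT -sum_nat_const; apply: eq_bigr => s _ /=.
  rewrite (reindex_inj (mulIg (val s)^-1%g)) /weight -sum1_card big_mkcond /=.
  by rewrite [RHS]big_mkcond; apply: eq_bigr => g _; rewrite inE mulgKV; case: eqP.
pose good g u := (L * word_weight (restr T g u) <= #|T|)%N.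
have pickg u : {g | (L * weight u <= n)%N -> good g u}.
  case: (pickP (good^~ u)) => [g gg|no]; first by exists g.
  exists 1%g => low; exfalso.
  have : (\sum_(g : gT) #|T|.+1 <= L * (#|T| * weight u))%N.
    rewrite -trans big_distrr /=; apply: leq_sum => g _.
    by have := no g; rewrite /good /= => /negbT; rewrite -ltnNge.
  rewrite sum_nat_const mulnCA => /leq_trans/(_ (leq_mul (leqnn _) low)).
  by rewrite mulnC leq_pmul2r // ltnn.
have [pg pgP] : exists pg : A -> gT, forall u,
  (L * weight u <= n)%N -> good (pg u) u.
  by exists (fun u => sval (pickg u)) => u; apply: (svalP (pickg u)).
(* Sorting the low words by their chosen translate produces the factor [n]; for a fixed [g],
   restriction to that translate embeds them into the low words on [T]. *)
rewrite -[X in X%:R <= _]sum1_card (partition_big pg xpredT) //=.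
rewrite natr_sum -[X in _ <= X%:R * _]sum1_card natr_sum mulr_suml;
  apply: ler_sum => g _; rewrite mul1r.
have -> : #|T| = #|{: {x : gT | x \in T}}| by rewrite cT.
apply: le_trans (@card_low_words R a L F {x : gT | x \in T} a_ge1 a_L).
rewrite ler_nat sum1_card -(@card_in_imset _ _ (restr T g)) => [|u v].
  apply/subset_leq_card/subsetP => _ /imsetP[u /andP[+ /eqP gE] ->].
  rewrite !inE => /andP[_ /pgP].
  by rewrite gE /good cT.
move=> /andP[/setIP[uI _] _] /andP[/setIP[vI _] _] /ffunP E.
apply/eqP; rewrite -subr_eq0 -[u - v](diracK g^-1%g) invgK.
rewrite [X in dirac g * X](T_inj (dirac g^-1%g * (u - v))) ?mulr0 //.
  exact/I_dirac/IB.
move=> x xT; rewrite coef_diracM invgK acoefD acoefN.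
by have := E (Sub x xT); rewrite !ffunE SubK => ->; rewrite subrr.
Qed.
End Subspace.

End GroupAlgebraIdeals.

(** * Minima and cyclotomic cosets *)

Section BigMin.
Variables (I : eqType) (m : nat) (E : I -> nat) (P : pred I) (r : seq I).

Lemma bigminn_le i : i \in r -> P i -> (\big[minn/m]_(j <- r | P j) E j <= E i)%N.
Proof.
elim: r => // j s IH; rewrite inE big_cons => /predU1P[<- ->|/IH {}IH /IH le].
  exact: geq_minl.
by case: ifP => // _; apply: leq_trans le; apply: geq_minr.
Qed.

Lemma bigminn_le_idx : (\big[minn/m]_(j <- r | P j) E j <= m)%N.
Proof. by apply: (big_rec (fun x => x <= m)%N) => // j k _ le;
  apply: leq_trans le; apply: geq_minr. Qed.

Lemma leq_bigminn k :
  (k <= m)%N -> (forall i,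
    P i -> (k <= E i)%N) -> (k <= \big[minn/m]_(j <- r | P j) E j)%N.
Proof. by move=> km kE; apply: (big_rec (fun x => k <= x)%N) => // i x Pi le;
  rewrite leq_min kE. Qed.

End BigMin.

Section CyclotomicCosets.
Variables (q n : nat).
Hypothesis n_gt1 : (1 < n)%N.
Let f (z : 'Z_n) : 'Z_n := q%:R * z.

Let iter_f k z : iter k f z = (q ^ k)%N%:R * z.
Proof. by elim: k => [|k IH]; rewrite ?mul1r //= IH /f mulrA -natrM -expnS. Qed.

Lemma mu_gt0 : (0 < mu q n)%N.
Proof.
apply: leq_bigminn => [|Q /andP[/imsetP[x _ ->] _]]; first exact: ltnW.
by apply/card_gt0P; exists x; rewrite inE -fconnect_orbit connect0.
Qed.

Lemma mu_le_n : (mu q n <= n)%N.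
Proof. exact: bigminn_le_idx. Qed.

(** The class of [n %/ D] is nonzero and is fixed by multiplication by [q ^ d], as [D] divides
    [q ^ d - 1]; hence its coset has at most [d] elements. *)
Lemma mu_le d D : (0 < d)%N -> (1 < D)%N -> (D %| n)%N -> (D %| (q ^ d).-1)%N ->
  (0 < q)%N -> (mu q n <= d)%N.
Proof.
move=> d0 D1 Dn Dq q0; pose x : 'Z_n := (n %/ D)%:R.
have nD0 : (0 < n %/ D)%N by rewrite divn_gt0 ?(ltnW D1) // dvdn_leq // ltnW.
have x0 : x != 0.
  rewrite -(inj_eq val_inj) /= /x val_Zp_nat // modn_small ?ltn_Pdiv // ?(ltnW
    n_gt1) //.
  by rewrite -lt0n.
have fx : iter d f x = x.
  rewrite iter_f -natrM; apply: val_inj; rewrite /= !val_Zp_nat //.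
  have qd0 : (0 < q ^ d)%N by rewrite expn_gt0 q0.
  apply/eqP; rewrite -(prednK qd0) mulSn -[X in _ == X %[mod _]]addn0 eqn_modDl
    mod0n.
  have /dvdnP[k ->] := Dq; rewrite -mulnA (mulnC D) divnK // modnMl.
  by [].
apply: (@leq_trans #|cyclotomic_coset q x|).
  apply: bigminn_le; rewrite ?mem_index_enum // imset_f //=.
  apply: contraNneq x0 => /setP/(_ x).
  by rewrite !inE -fconnect_orbit connect0 => /esym.
rewrite -[X in (_ <= X)%N]card_ord -cardsT.
apply: leq_trans (leq_imset_card (fun i : 'I_d => iter i f x) _).
apply/subset_leq_card/subsetP => y; rewrite inE -fconnect_orbit => /iter_findex <-.
set k := findex _ _ _; apply/imsetP; exists (Ordinal (ltn_pmod k d0)) => //=.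
rewrite [in LHS](divn_eq k d) addnC iterD; congr iter.
by elim: (k %/ d)%N => // j IH; rewrite mulSn iterD IH fx.
Qed.

End CyclotomicCosets.

(** * The trivial component and the dimensions of the other ones *)

Section TrivialComponent.
Variables (F : finFieldType) (gT : finGroupType) (ab : abelian [set: gT]).
Local Notation A := (abelian_algebra F ab).
Local Notation q := #|F|.
Local Notation n := #|gT|.
Hypothesis n_q : coprime n q.
Implicit Types (u v e p : A) (g h x : gT).

Lemma order_neq0 : n%:R != 0 :> F.
Proof.
have [r r_pr rF] := finPcharP F.
rewrite -(dvdn_pcharf rF); apply/negP => rn.
have rq : (r %| q)%N.
  have qE : q = (r ^ logn r q)%N by exact: (card_pprimeChar rF).
  rewrite qE; have := finNzRing_gt1 F; rewrite {1}qE.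
  by case: (logn r q) => // k _; rewrite expnS dvdn_mulr.
have : (r %| gcdn n q)%N by rewrite dvdn_gcd rn.
by rewrite (eqP n_q) dvdn1 => /eqP r1; rewrite r1 in r_pr.
Qed.

(** The average of the group elements; its ideal consists of the constant words. *)
Definition trivial_idem : A := sval (coef_surj ab (fun _ : gT => n%:R^-1 : F)).
Local Notation e0 := trivial_idem.

Lemma coef_trivial x : coef e0 x = n%:R^-1.
Proof. exact: (svalP (coef_surj _ _)). Qed.

Lemma coef_trivialM u x : coef (e0 * u) x = n%:R^-1 * \sum_g coef u g.
Proof.
rewrite mulrC acoefM mulrC mulr_suml; apply: eq_bigr => g _.
by rewrite coef_trivial.
Qed.

Lemma idem_trivial : idem e0.
Proof.
apply/eqP/acoefP => x; rewrite coef_trivialM coef_trivial.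
rewrite (eq_bigr (fun=> n%:R^-1)) => [|g _]; last exact: coef_trivial.
by rewrite sumr_const -[X in _ * X]mulr_natr mulVf ?mulr1 // order_neq0.
Qed.

Lemma bar_trivial : bar e0 = e0.
Proof. by apply: acoefP => x; rewrite coef_bar !coef_trivial. Qed.

Lemma card_corner_trivial : #|corner e0| = q.
Proof.
have inj : injective (fun k : F => k *: e0).
  move=> k l /(congr1 (fun u : A => coef u 1%g)); rewrite !acoefZ coef_trivial.
  by apply: mulIf; rewrite invr_eq0 order_neq0.
rewrite -[RHS](card_imset _ inj); apply: eq_card => u; apply/cornerP/imsetP.
  move=> ue; exists (\sum_g coef u g) => //; apply: acoefP => x.
  by rewrite -ue coef_trivialM ue acoefZ coef_trivial mulrC.
by case=> k _ ->; rewrite -scalerAr (eqP idem_trivial).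
Qed.

Lemma weight_trivial u : u \in corner e0 -> u != 0 -> weight u = n.
Proof.
move=> /cornerP ue u0; rewrite /weight -cardsT; apply: eq_card => x; rewrite !inE.
apply: contra_neqT u0; rewrite negbK -{1}ue coef_trivialM => /eqP h.
by apply: acoefP => y; rewrite -ue coef_trivialM h acoef0.
Qed.

(** If all group elements fixed [p], so would their average [e0], forcing [p = p * e0 = 0]. *)
Lemma dirac_neq p : p != 0 -> p * e0 = 0 -> exists g, p * dirac F ab g != p.
Proof.
move=> p0 pe; apply/existsP; apply: contraNT p0; rewrite negb_exists => /forallP h.
rewrite -pe; apply/eqP; apply: acoefP => x;
  rewrite (dirac_sum e0) mulr_sumr acoef_sum.
rewrite (eq_bigr (fun=> n%:R^-1 * coef p x)) => [|g _].
  by rewrite sumr_const -[RHS]mulr_natl mulrA mulfV ?mul1r // order_neq0.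
by rewrite -scalerAr acoefZ coef_trivial; have := h g; rewrite negbK => /eqP ->.
Qed.

(** By Bezout, a multiple of [k] is a multiple of [l] plus the gcd, and multiples of fixing
    exponents fix [p]. *)
Lemma atom_stab p g k l : p * dirac F ab (g ^+ k)%g = p ->
  p * dirac F ab (g ^+ l)%g = p ->
  (0 < k)%N -> p * dirac F ab (g ^+ gcdn k l)%g = p.
Proof.
move=> hk hl k0; have mul i j : p * dirac F ab (g ^+ i)%g = p ->
    p * dirac F ab (g ^+ (j * i))%g = p.
  by move=> hi; rewrite mulnC expgM diracX; elim: j => [|j IH];
    rewrite ?mulr1 // exprSr mulrA IH.
have [a b ab' _] := egcdnP l k0.
by have := mul k a hk; rewrite ab' expgD diracM mulrA mul.
Qed.

(** Some [g] has an image in the field [corner p] other than its identity [p]. The order of that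
    image divides [n] and [#|corner p| - 1], so these share a divisor above 1 and [mu_le] applies.
    If [bar p = p], then [bar] inverts this image, which is not its own inverse because [n] is
    odd. *)
Lemma atom_trivial N p : (forall u, u ^+ N.+3 = u) -> odd n ->
    atom p -> p * e0 = 0 ->
  [/\ (mu q n <= trunc_log q #|corner p|)%N, (2 < #|corner p|)%N
    & bar p = p -> exists2 x, x \in corner p & bar x != x].
Proof.
move=> per n_odd ap pe; have [p0 pp _] := atomP _ ap.
have q1 := finNzRing_gt1 F.
have [g pg] := dirac_neq p0 pe.
have pg0 : p * dirac F ab g != 0.
  apply: contra_neq p0 => h; rewrite -[p]mulr1 -(dirac1 F ab) -(mulgV g).
  by rewrite diracM mulrA h mul0r.
have pgc h : p * dirac F ab h \in corner p by apply/cornerP; rewrite mulrA pp.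
have gn : (g ^+ n = 1)%g by rewrite -cardsT expg_cardG ?inE.
have n0 : (0 < n)%N by apply/card_gt0P; exists 1%g.
have stab_n : p * dirac F ab (g ^+ n)%g = p by rewrite gn dirac1 mulr1.
have n1 : (1 < n)%N.
  rewrite ltn_neqAle n0 andbT; apply: contra_neq pg => h.
  by rewrite -h expg1 in stab_n.
split.
- have lin (k : F) u v : u \in corner p -> v \in corner p ->
  k *: u + v \in corner p.
    move=> /cornerP pu /cornerP pv; apply/cornerP.
    by rewrite mulrDr -scalerAr pu pv.
  have [T [cT _]] := information_set (introT (cornerP p 0) (mulr0 _)) lin.
  rewrite cT trunc_expnK //.
  have T0 : (0 < #|T|)%N.
    rewrite lt0n; apply: contra_neq p0 => T0; move: cT; rewrite T0 expn0.
    by move/eqP; rewrite eqn_leq => /andP[/card_le1_eqP h _]; apply: h;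
      apply/cornerP; rewrite ?mulr0.
  pose D := gcdn n (q ^ #|T|).-1.
  have qT1 : (1 < q ^ #|T|)%N by rewrite -{1}(exp1n #|T|) ltn_exp2r.
  apply: (@mu_le _ _ n1 _ D) => //; rewrite ?dvdn_gcdl ?dvdn_gcdr //;
    last exact: ltnW.
  have D0 : (0 < D)%N by rewrite gcdn_gt0 n0.
  rewrite ltn_neqAle D0 andbT; apply: contra_neq pg => D1.
  rewrite -{2}(@atom_stab p g n (q ^ #|T|).-1) // -/D -?D1 ?expg1 //.
  have := atom_expr_card per ap (pgc g) pg0; rewrite cT.
  case: (_.-1) (qT1) => [|k _]; first by rewrite expg0 dirac1 mulr1.
  rewrite exprMn -diracX => h; rewrite -[RHS]h exprSr.
  suff -> : p ^+ k * p = p by [].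
  by elim: k {h} => [|k IH]; rewrite ?mul1r // exprSr -mulrA pp.
- rewrite (cardsD1 0) inE mulr0 eqxx (cardsD1 p) !inE p0 pp eqxx.
  rewrite (cardsD1 (p * dirac F ab g)) !in_setD1 pg pg0 pgc.
  by [].
move=> bp; exists (p * dirac F ab g) => //.
apply: contra_neq pg; rewrite rmorphM /= bp bar_dirac => h.
have stab_2 : p * dirac F ab (g ^+ 2)%g = p.
  by rewrite expgS expg1 diracM mulrA -h -mulrA -diracM mulVg dirac1 mulr1.
have := @atom_stab p g 2 n stab_2 stab_n; rewrite (_ : gcdn 2 n = 1%N) ?expg1;
  first exact.
by apply/eqP; rewrite -/(coprime 2 n) coprime2n.
Qed.

End TrivialComponent.

(** * Good unitary elements in group algebras *)

Lemma good_unitary_exists (R : realFieldType) (a : R) (L : nat)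
    (F : finFieldType) (gT : finGroupType) (ab : abelian [set: gT]) :
    1 < a -> a ^+ 48 <= #|F|%:R -> #|F|%:R <= (a - 1) * a ^+ L -> (1 < L)%N ->
    (1 < #|gT|)%N -> odd #|gT| -> coprime #|gT| #|F| ->
    #|gT|%:R <= a ^+ mu #|F| #|gT| ->
  exists2 c : abelian_algebra F ab, c * bar c = 1 &
    forall u, (L * weight u <= #|gT|)%N -> (L * weight (u * c)%R <= #|gT|)%N ->
      u = 0.
Proof.
move=> a1 aq aL L1 n1 n_odd n_q n_mu.
set n := #|gT| in n1 n_odd n_q n_mu *; set q := #|F| in aq aL n_q n_mu *.
have n2 : (2 < n)%N by case: (n) n_odd n1 => [|[|[|]]].
have q1 : (1 < q)%N := finNzRing_gt1 F.
have [N per] := group_algebra_periodic ab n_q.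
(* Ideals are [F]-subspaces, so their sizes are exact powers of [q] and the truncated logarithm is
   the dimension. *)
pose d (e : abelian_algebra F ab) := trunc_log q #|corner e|.
have lin (e : abelian_algebra F ab) (k : F) (u v : abelian_algebra F ab) : u
  \in corner e -> v \in corner e -> k *: u + v \in corner e.
  move=> /cornerP pu /cornerP pv; apply/cornerP.
  by rewrite mulrDr -scalerAr pu pv.
have card_corner (e : abelian_algebra F ab) : #|corner e| = (q ^ d e)%N.
  have [T [cT _]] := information_set (introT (cornerP e 0) (mulr0 _)) (@lin e).
  by rewrite /d cT trunc_expnK.
have d1 : d 1 = n.
  rewrite /d -[RHS](trunc_expnK n q1); congr (trunc_log q _).
  have -> : corner (1 : abelian_algebra F ab) = [set: abelian_algebra F ab].
    by apply/setP => x; rewrite !inE mul1r eqxx.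
  by rewrite cardsT; exact: (card_ffun gT F).
have de0 : d (trivial_idem F ab) = 1%N.
  by rewrite /d card_corner_trivial // -[RHS](trunc_expnK 1 q1) expn1.
pose low := [set u : abelian_algebra F ab | (L * weight u <= n)%N].
have low_card (e : abelian_algebra F ab) : idem e ->
  #|corner e :&: low|%:R <= n%:R * a ^+ (2 * d e).
  move=> _; apply: (card_low_ideal (introT (cornerP e 0) (mulr0 _)) (@lin e)
    (ltW a1) aL) => //.
  by move=> g u /cornerP eu; apply/cornerP; rewrite mulrCA eu.
(* A nonzero constant word has full weight [n], which is not low since [L > 1]. *)
have low_trivial u : u \in corner (trivial_idem F ab) -> u \in low -> u = 0.
  move=> uc; rewrite inE; have [//|u0] := eqVneq u 0.
  rewrite (weight_trivial uc u0) -/n; move: n1 L1; clear; nia.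
have [c cc cP] := exists_good_unitary (@barK F gT ab) per q1 n2 a1 aq n_mu
  (fun e _ => card_corner e) d1 (idem_trivial ab n_q) (bar_trivial F ab) de0
  low_card low_trivial (fun p ap pe => atom_trivial n_q per n_odd ap pe).
by exists c => // u ul ucl; apply: cP; rewrite inE.
Qed.

(** * The codes of type I: self-duality and minimum weight *)

Section CodeSpace.
Variables (F : finFieldType) (gT : finGroupType).
Local Notation FG := (group_algebra F gT).

Definition code1_map (b u : FG) : FG * FG := (u, u * b).

Fact code1_map_is_linear b : linear (code1_map b).
Proof. by move=> k u v; congr (_, _); rewrite mulrDl -scalerAl. Qed.

HB.instance Definition _ b :=
  GRing.isLinear.Build F FG (FG * FG)%type *:%R (code1_map b)
    (code1_map_is_linear b).

Definition code1_space b : {vspace FG * FG} := limg (linfun (code1_map b)).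

Lemma mem_code1_space b : code1_space b =i code1 b.
Proof.
move=> v; apply/memv_imgP/imsetP => -[u _ ->]; exists u; rewrite ?memvf //;
  by rewrite lfunE.
Qed.

Lemma dim_code1_space b : \dim (code1_space b) = #|gT|.
Proof.
rewrite /code1_space limg_dim_eq; last first.
  apply/eqP; rewrite -subv0; apply/subvP => u /memv_capP[_].
  by rewrite memv_ker lfunE => /eqP[-> _]; apply: mem0v.
by rewrite dimvf; rewrite /dim /= muln1.
Qed.

Lemma quasi_code1_space b : quasi_FG_code (code1_space b).
Proof.
move=> a v; rewrite !mem_code1_space => /imsetP[u _ ->] /=.
by apply/imsetP; exists (a * u); rewrite //= mulrA.
Qed.

Lemma type_I_code1_space b : type_I (code1_space b).
Proof. by exists b; apply: mem_code1_space. Qed.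

Lemma min_weight_ge b m k :
    (m <= k * #|gT|)%N ->
    (forall u : FG, u != 0 -> (m <= k * hamming_weight (code1_map b u))%N) ->
  (m <= k * min_weight (code1_space b))%N.
Proof.
move=> mk h; apply: (big_rec (fun x => m <= k * x)%N) => [|v x /andP[vC v0] mx].
  (* The default value [code_length] of the minimum is covered by the hypothesis on [k * #|gT|]. *)
  by rewrite (leq_trans mk) // leq_mul2l /code_length leq_pmull ?orbT.
rewrite /minn; case: ifP => // _; move: vC v0; rewrite mem_code1_space.
move=> /imsetP[u _ ->] u0; apply: h; apply: contra_neq u0 => ->.
by rewrite mul0r.
Qed.

Variable ab : abelian [set: gT].

(** The inner product of [(w1, w2)] with [(u, u * b)] is the coefficient at the identity of
    [(w1 + w2 * bar b) * bar u]. With [u] running over the group elements, orthogonality to the code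
    means [w1 = - w2 * bar b], that is [w2 = w1 * b]. *)
Lemma self_dual_code1_space (b : abelian_algebra F ab) :
  b * bar b = -1 -> self_dual (code1_space (b : FG)).
Proof.
move=> bb v; rewrite mem_code1_space /dual_code inE.
have ip (w w' : abelian_algebra F ab) : \sum_x coef w x * coef w' x = coef (w *
  bar w') 1%g.
  by rewrite acoefM; apply: eq_bigr => x _; rewrite coef_bar mulg1 invgK.
have ipE (u w1 w2 : abelian_algebra F ab) :
    inner_product ((w1, w2) : FG * FG) ((u,
      u * b) : FG * FG) = coef ((w1 + w2 * bar b) * bar u) 1%g.
  have -> : (w1 + w2 * bar b) * bar u = w1 * bar u + w2 * bar (u * b).
    by rewrite rmorphM /=; ring.
  by rewrite acoefD -!ip -big_split.
case: v => v1 v2; apply/imsetP/forall_inP => [[u _ [-> ->]] c|h].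
  rewrite mem_code1_space => /imsetP[w _ ->];
    rewrite (ipE w u (u * b : abelian_algebra F ab)).
  by rewrite -mulrA bb mulrN1 subrr mul0r acoef0.
have v0 : (v1 : abelian_algebra F ab) + (v2 : abelian_algebra F ab) * bar b = 0.
  apply: acoefP => x; have := h (code1_map b (dirac F ab x)).
  rewrite mem_code1_space imset_f // => /(_ isT).
  rewrite (ipE (dirac F ab x)) bar_dirac mulrC coef_diracM invgK mulg1 => /eqP ->.
  by rewrite acoef0.
exists v1 => //; congr (_, _).
have E : (v1 : abelian_algebra F ab) = - (v2 : abelian_algebra F ab) * bar b.
  by rewrite mulNr; apply/eqP; rewrite -addr_eq0 v0.
have : (v1 : abelian_algebra F ab) * b = v2.
  by rewrite E -mulrA [bar b * b]mulrC bb mulrN1 opprK.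
by move=> <-.
Qed.

End CodeSpace.

(** In characteristic 2 take 1. Otherwise [#|F| = 4 * k + 1], the polynomial ['X^(2 * k) - 1] has
    too few roots to kill every nonzero element, and [x ^+ k] works for a nonzero [x] that is not a
    root. *)
Lemma sqrt_minus1 (F : finFieldType) :
  ~~ odd #|F| \/ #|F| = 1 %[mod 4] -> exists s : F, s * s = -1.
Proof.
case=> [q_even|q1].
  have [r r_pr rF] := finPcharP F.
  have qE : #|F| = (r ^ logn r #|F|)%N by exact: (card_pprimeChar rF).
  have r2 : r = 2%N.
    by case: (even_prime r_pr) => // r_odd; rewrite qE oddX r_odd orbT in q_even.
  rewrite r2 in rF; exists 1; rewrite mulr1; apply/eqP.
  by rewrite -addr_eq0 -mulr2n; have /andP[_] := rF.
have F1 := finNzRing_gt1 F.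
pose k := (#|F| %/ 4)%N.
have qk : #|F| = (4 * k).+1 by rewrite {1}(divn_eq #|F| 4) q1 /k; lia.
have k0 : (0 < k)%N by move: F1; rewrite qk; case: (k).
have [x x0 xk] : exists2 x : F, x != 0 & x ^+ (2 * k) != 1.
  apply/exists_inP; apply: contraT; rewrite negb_exists_in => /forall_inP h.
  pose P : {poly F} := 'X^(2 * k) - 1.
  have k2 : (0 < 2 * k)%N by rewrite muln_gt0.
  have P0 : P != 0 by rewrite -size_poly_eq0 size_XnsubC.
  have := @max_poly_roots _ P (enum [set~ (0 : F)]) P0.
  rewrite enum_uniq -cardE cardsC1 qk /= size_XnsubC // => H.
  have : (4 * k < (2 * k).+1)%N.
    apply: H => //; apply/allP => y; rewrite mem_enum !inE => /h.
    by rewrite negbK /root !hornerE => /eqP ->; rewrite subrr.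
  by move: k0; clear; lia.
exists (x ^+ k); rewrite -exprD addnn -mul2n.
have : (x ^+ (2 * k)) ^+ 2 = 1.
  rewrite -exprM; apply: (mulfI x0); rewrite mulr1 -exprS.
  by have := expf_card x; rewrite {1}qk mulnAC.
by move/eqP; rewrite sqrf_eq1 (negPf xk) /= => /eqP.
Qed.

(** Scaling by the nonzero [s] turns [c * bar c = 1] into [b * bar b = -1] and preserves weights. *)
Lemma exists_good_code (F : finFieldType) (gT : finGroupType)
    (ab : abelian [set: gT]) (s : F) (m k : nat) (c : abelian_algebra F ab) :
    s * s = -1 -> c * bar c = 1 -> (m <= k * #|gT|)%N ->
    (forall u, u != 0 -> (m <= k * (weight u + weight (u * c)%R))%N) ->
  exists C : {vspace group_algebra F gT * group_algebra F gT},
    [/\ [/\ quasi_FG_code C, self_dual C & type_I C], \dim C = #|gT|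
      & (m <= k * min_weight C)%N].
Proof.
move=> ss cc mk h; have s0 : s != 0.
  by apply: contra_eq_neq ss => ->; rewrite mul0r eq_sym oppr_eq0 oner_neq0.
pose b : abelian_algebra F ab := s *: c.
exists (code1_space (b : group_algebra F gT)); split.
- split; [exact: quasi_code1_space| |exact: type_I_code1_space].
  apply: (@self_dual_code1_space _ _ ab).
  have -> : bar b = s *: bar c by apply: acoefP => x; rewrite !(coef_bar, acoefZ).
  by rewrite /b -scalerAl -scalerAr scalerA cc ss scaleN1r.
- exact: dim_code1_space.
apply: min_weight_ge => // u u0.
suff -> : hamming_weight (code1_map (b : group_algebra F gT) u) =
    (weight (u : abelian_algebra F ab) + weight ((u : abelian_algebra F ab) *
      c)%R)%N by exact: h.
rewrite /hamming_weight /code1_map /=; congr (_ + _)%N; apply: eq_card => x;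
  rewrite !inE.
have E : coef ((u : abelian_algebra F ab) * b) x = s * coef ((u :
  abelian_algebra F ab) * c) x.
  by rewrite /b -scalerAr acoefZ.
by rewrite [coef _ x]E mulf_eq0 (negPf s0).
Qed.

Lemma weight_gt0 (F : finFieldType) (gT : finGroupType) (ab : abelian [set: gT])
  (u : abelian_algebra F ab) : u != 0 -> (0 < weight u)%N.
Proof.
apply: contra_neqT; rewrite -leqNgt leqn0 cards_eq0 => /eqP u0; apply: acoefP => x.
apply/eqP; rewrite acoef0; have := in_set0 x; rewrite -u0 inE.
by move/negbFE.
Qed.

(* Choice of the constants and asymptotics *)
From mathcomp Require Import all_classical all_reals all_analysis.
Import Order.TTheory GRing.Theory Num.Theory.
Import numFieldNormedType.Exports.

Theorem theorem4p17 (R : realType) (F : finFieldType) (n : nat -> nat)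
    (n_gt1 : forall i, (1 < n i)%N)
    (n_odd : forall i, odd (n i))
    (n_coprime : forall i, coprime (n i) #|F|)
    (n_lim : (log_base (#|F|%:R : R) (n i)%:R / (mu #|F| (n i))%:R
                @[i --> \oo] --> (0 : R))%classic)
    (gT : nat -> finGroupType)
    (gT_abelian : forall i, abelian [set: gT i])
    (gT_order : forall i, #|gT i| = n i)
    (q_cond : ~~ odd #|F| \/ #|F| = 1 %[mod 4]) :
  exists C : forall i,
      {vspace group_algebra F (gT i) * group_algebra F (gT i)},
    (forall i, [/\ quasi_FG_code (C i), self_dual (C i) & type_I (C i)])
    /\ asymptotically_good R C.
Proof.
have [s ss] := sqrt_minus1 q_cond.
have q1 : (1 < #|F|)%N := finNzRing_gt1 F.
pose lq : R := ln #|F|%:R.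
have q0 : 0 < #|F|%:R :> R by rewrite ltr0n ltnW.
have lq0 : 0 < lq by rewrite ln_gt0 // ltr1n.
have mu0 i : 0 < (mu #|F| (n i))%:R :> R by rewrite ltr0n mu_gt0.
have key (eps : R) : 0 < eps ->
    exists N0, forall i, (N0 <= i)%N -> ln (n i)%:R < eps * (mu #|F| (n i))%:R * lq.
  move=> eps0; have [N0 _ H] := cvgr_lt _ n_lim _ eps0.
  exists N0 => i /H /=; rewrite /log_base ltr_pdivrMr // ltr_pdivrMr //.
(* The 48th root of [q], as the union bound demands. *)
pose a : R := expR (lq / 48%:R).
have a1 : 1 < a by rewrite expR_gt1 divr_gt0.
have aq : a ^+ 48 <= #|F|%:R.
  by rewrite -expRM_natl mulrCA mulfV ?pnatr_eq0 // mulr1 lnK.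
have [L L1 aL] : exists2 L, (1 < L)%N & #|F|%:R <= (a - 1) * a ^+ L.
  have b0 : 0 < a - 1 by rewrite subr_gt0.
  (* Since [a ^+ L >= L * (a - 1)], it suffices that [L] be at least [q / (a - 1) ^ 2]; the two
     successors also ensure [L > 1]. *)
  pose L := (Num.trunc (#|F|%:R / (a - 1) ^+ 2)).+2; exists L => //.
  have : #|F|%:R / (a - 1) ^+ 2 <= L%:R.
    apply: ltW; apply: lt_trans (truncnS_gt _) _.
    by rewrite ltr_nat.
  rewrite ler_pdivrMr ?exprn_gt0 // => /le_trans; apply.
  rewrite expr2 mulrA [leRHS]mulrC ler_pM2r //.
  elim: (L) => [|k IH]; first by rewrite mul0r expr0.
  have ak : 1 <= a ^+ k by rewrite exprn_ege1 // ltW.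
  rewrite exprS -natr1; move: IH ak b0; move: (k%:R) (a ^+ k) => x y; nra.
have [N0 HN0] : exists N0, forall i, (N0 <= i)%N -> (n i)%:R <= a ^+ mu #|F| (n i).
  have [|N0 H] := key (48%:R^-1); first by rewrite invr_gt0.
  exists N0 => i /H h; rewrite -[leLHS]lnK ?posrE ?ltr0n 1?ltnW //.
  rewrite -expRM_natl ler_expR; apply: ltW; apply: lt_le_trans h _.
  by rewrite [leRHS]mulrA [leRHS]mulrC mulrA.
(* The sum absorbs the finitely many indices below [N0], where [c = 1] and the trivial bound of
   weight at least 1 suffice. *)
pose M := (L + \sum_(i < N0) n i)%N.
have good i : exists C : {vspace group_algebra F (gT i) * group_algebra F (gT i)},
    [/\ [/\ quasi_FG_code C, self_dual C & type_I C], \dim C = #|gT i|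
      & (n i <= M * min_weight C)%N].
  have M0 : (0 < M)%N by rewrite addn_gt0 ltnW.
  have nM : (n i <= M * #|gT i|)%N by rewrite gT_order leq_pmull.
  have [le|lt] := leqP N0 i.
    have [||||c cc cP] := @good_unitary_exists R a L F (gT i) (gT_abelian i) a1
      aq aL L1.
    - by rewrite gT_order.
    - by rewrite gT_order.
    - by rewrite gT_order.
    - by rewrite gT_order; apply: HN0.
    apply: (exists_good_code ss cc nM) => u u0.
    apply: (@leq_trans (L * (weight u + weight (u * c)%R)));
      last by rewrite leq_mul2r leq_addr orbT.
    rewrite mulnDr; have [h1|h1] := leqP (L * weight u)%N (n i); last first.
      by apply: leq_trans (ltnW h1) _; apply: leq_addr.
    have [h2|h2] := leqP (L * weight (u * c)%R)%N (n i); last first.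
      by apply: leq_trans (ltnW h2) _; apply: leq_addl.
    by case/eqP: u0; apply: cP; rewrite gT_order.
  apply: (exists_good_code (c := 1 : abelian_algebra F (gT_abelian i)) ss _ nM).
    by rewrite mul1r; exact: (rmorph1 (bar (ab := gT_abelian i))).
  move=> u u0; have w0 := weight_gt0 u0.
  apply: (@leq_trans M); last by rewrite leq_pmulr // addn_gt0 w0.
  rewrite /M (bigD1 (Ordinal lt)) //=; lia.
pose C i := projT1 (cid (good i)); exists C.
have CP i : [/\ [/\ quasi_FG_code (C i), self_dual (C i) & type_I (C i)],
  \dim (C i) = #|gT i|
      & (n i <= M * min_weight (C i))%N] := projT2 (cid (good i)).
split; first by move=> i; have [] := CP i.
split.
  apply/cvgnyPge => K; have l20 : 0 < ln 2 :> R by rewrite ln_gt0 // ltr1n.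
  (* With this choice, [ln 2 <= ln (n i)] forces [K.+1 < mu], and [mu] is at most [n i]. *)
  have [|N1 H] := key (ln 2 / lq / K.+1%:R); first by rewrite !divr_gt0.
  exists N1 => // i /= /H h; rewrite /code_length gT_order.
  suff : (K <= n i)%N by move=> Kn; apply: leq_trans Kn _; rewrite leq_pmull.
  apply: leq_trans (mu_le_n #|F| (n i)); apply: ltnW; apply: ltnW.
  have ln2 : ln 2 <= ln (n i)%:R :> R
    by rewrite ler_ln ?posrE ?ltr0n ?ler_nat // ltnW.
  have K0 : 0 < K.+1%:R :> R by [].
  have E (x y z w : R) : y != 0 -> z != 0 -> x / z / y * w * z = x * (w / y).
    by move=> y0 z0; field; rewrite y0 z0.
  have := le_lt_trans ln2 h; rewrite E ?(gt_eqF K0) ?(gt_eqF lq0) //.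
  by rewrite ltr_pMr // ltr_pdivlMr // mul1r ltr_nat.
have M0 : (0 < M)%N by rewrite addn_gt0 ltnW.
(* The rate is one half, and the minimum weight is at least [n i / M] for length [2 * n i]. *)
exists ((2 * M)%N%:R^-1); first by rewrite invr_gt0 ltr0n muln_gt0.
move=> i; have [_ dimC wC] := CP i.
have g0 : (0 < #|gT i|)%N by rewrite gT_order ltnW.
have c0 : 0 < (code_length (gT i))%:R :> R by rewrite ltr0n muln_gt0.
have M2 : 0 < (2 * M)%N%:R :> R by rewrite ltr0n muln_gt0.
split; rewrite ler_pdivlMr // ler_pdivrMl // -natrM ler_nat /code_length.
  by rewrite dimC -mulnA leq_mul2l /= leq_pmull.
by rewrite gT_order -mulnA leq_mul2l.
Qed.
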